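(* Let $n\ge2$, let $\phi_1,\dots,\phi_n:\mathbb{R}^m\to\mathbb{R}$ be convex, differentiable with $(1/\gamma)$-Lipschitz gradients ($\gamma>0$), let $g:\mathbb{R}^d\to\mathbb{R}$ be $1$-strongly convex, $\lambda>0$, and let $A_1,\dots,A_n\in\mathbb{R}^{d\times m}$ be nonzero. Let $A_{ji}\in\mathbb{R}^{1\times m}$ be the $j$-th row of $A_i$ and $\omega_j=|\{i\in[n]:A_{ji}\ne0\}|$ for $j\in[d]$. Let $\tau\in[n]$ and suppose the algorithm Quartz (described in the context) is run with $\hat S$ the $\tau$-nice sampling (a subset of $[n]$ of cardinality $\tau$ chosen uniformly at random) and $$v_i=\lambda_{\max}\left(\sum_{j=1}^d\left(1+\frac{(\omega_j-1)(\tau-1)}{n-1}\right)A_{ji}^\top A_{ji}\right),\qquad i\in[n].$$ If $0<\epsilon\le P(w^0)-D(\alpha^0)$ and the integer $T$ satisfies $$T\ge\left(\frac n\tau+\frac{\max_i\lambda_{\max}\left(\sum_{j=1}^d\left(1+\frac{(\omega_j-1)(\tau-1)}{n-1}\right)A_{ji}^\top A_{ji}\right)}{\lambda\gamma\tau}\right)\log\left(\frac{P(w^0)-D(\alpha^0)}{\epsilon}\right),$$ then $\mathbb{E}[P(w^T)-D(\alpha^T)]\le\epsilon$.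
   Context: $[n]=\{1,\dots,n\}$; $\|\cdot\|$ is the Euclidean norm. $g$ is $1$-strongly convex means $g(w)\ge g(w')+\langle s,w-w'\rangle+\tfrac12\|w-w'\|^2$ for all $w,w'$ and every subgradient $s$ of $g$ at $w'$. $\xi^*(u)=\sup_s\{\langle s,u\rangle-\xi(s)\}$ is the convex (Fenchel) conjugate (possibly $+\infty$ for $\phi_i^*$; $g^*$ is finite and $1$-smooth). The primal and dual objectives are $$P(w)=\frac1n\sum_{i=1}^n\phi_i(A_i^\top w)+\lambda g(w),\quad w\in\mathbb{R}^d,$$ $$D(\alpha)=-\lambda g^*\Big(\frac1{\lambda n}\sum_{i=1}^nA_i\alpha_i\Big)-\frac1n\sum_{i=1}^n\phi_i^*(-\alpha_i),\quad \alpha=(\alpha_1,\dots,\alpha_n)\in(\mathbb{R}^m)^n.$$ Algorithm Quartz (with random set $\hat S\subseteq[n]$, $p_i=\mathbb{P}(i\in\hat S)>0$, and positive vector $v\in\mathbb{R}^n$): choose $\alpha^0\in(\mathbb{R}^m)^n$, $w^0\in\mathbb{R}^d$ (deterministic); set $\theta=\min_i\frac{p_i\lambda\gamma n}{v_i+\lambda\gamma n}$ and $\bar\alpha^0=\frac1{\lambda n}\sum_iA_i\alpha_i^0$. For $t=1,2,\dots$: (1) $w^t=(1-\theta)w^{t-1}+\theta\nabla g^*(\bar\alpha^{t-1})$; (2) draw a random set $S_t\subseteq[n]$ with the distribution of $\hat S$, independently of all previous draws; (3) for $i\notin S_t$ put $\alpha_i^t=\alpha_i^{t-1}$; for $i\in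 S_t$ put $\alpha_i^t=\alpha_i^{t-1}+\Delta\alpha_i^t$, where $\Delta\alpha_i^t$ is given by one of the two options (the result holds for either option): Option I: $\Delta\alpha_i^t=\arg\max_{\Delta\in\mathbb{R}^m}\big[-\phi_i^*(-(\alpha_i^{t-1}+\Delta))-\nabla g^*(\bar\alpha^{t-1})^\top A_i\Delta-\frac{v_i\|\Delta\|^2}{2\lambda n}\big]$; Option II: $\Delta\alpha_i^t=-\theta p_i^{-1}\alpha_i^{t-1}-\theta p_i^{-1}\nabla\phi_i(A_i^\top w^t)$; (4) $\bar\alpha^t=\bar\alpha^{t-1}+\frac1{\lambda n}\sum_{i\in S_t}A_i\Delta\alpha_i^t$ (so $\bar\alpha^t=\frac1{\lambda n}\sum_iA_i\alpha_i^t$). *)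

(* Defs.v *)
From HB Require Import structures.
From mathcomp Require Import all_boot all_order all_algebra.
From mathcomp Require Import all_classical all_reals all_analysis.

Set Implicit Arguments.
Unset Strict Implicit.
Unset Printing Implicit Defensive.

Import Order.TTheory GRing.Theory Num.Theory.
Import numFieldNormedType.Exports.

Local Open Scope classical_set_scope.
Local Open Scope ring_scope.

Definition edot (R : realType) (k : nat) (x y : 'cV[R]_k) : R :=
  \sum_(i < k) x i 0 * y i 0.

(* The library norm on matrices is the sup norm, so the Euclidean one is
   defined here. *)
Definition enorm (R : realType) (k : nat) (x : 'cV[R]_k) : R :=
  Num.sqrt (edot x x).

(* The gradient as the vector of partial derivatives. *)
Definition grad (R : realType) (k : nat) (f : 'cV[R]_k -> R) (x : 'cV[R]_k) :
    'cV[R]_k :=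
  \col_i 'D_(delta_mx i 0) f x.

Definition subgradient (R : realType) (k : nat) (f : 'cV[R]_k -> R)
    (x s : 'cV[R]_k) : Prop :=
  forall y, f x + edot s (y - x) <= f y.

(* Convexity is part of the definition: without it the subgradient inequality
   holds vacuously for functions that have no subgradient at all. *)
Definition strongly_convex1 (R : realType) (k : nat) (g : 'cV[R]_k -> R) :
    Prop :=
  convex_function setT g /\
  forall w w' s, subgradient g w' s ->
    g w' + edot s (w - w') + enorm (w - w') ^+ 2 / 2 <= g w.

Definition fconj (R : realType) (k : nat) (f : 'cV[R]_k -> R)
    (u : 'cV[R]_k) : \bar R :=
  ereal_sup [set (edot s u - f s)%:E | s in [set: 'cV[R]_k]].

(* For strongly convex g the conjugate is finite, so "fine" only changes the
   codomain to R. *)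
Definition grad_fconj (R : realType) (k : nat) (g : 'cV[R]_k -> R)
    (u : 'cV[R]_k) : 'cV[R]_k :=
  grad (fun x => fine (fconj g x)) u.

(* The largest eigenvalue of a matrix with a nonempty spectrum: the set of
   eigenvalues is finite, so the supremum is a maximum. *)
Definition lambda_max (R : realType) (k : nat) (M : 'M[R]_k) : R :=
  sup [set a : R | eigenvalue M a].

Definition alpha_bar (R : realType) (n d m : nat) (A : 'I_n -> 'M[R]_(d, m))
    (lambda : R) (alpha : 'I_n -> 'cV[R]_m) : 'cV[R]_d :=
  (lambda * n%:R)^-1 *: \sum_(i < n) A i *m alpha i.

Definition primal (R : realType) (n d m : nat) (A : 'I_n -> 'M[R]_(d, m))
    (phi : 'I_n -> 'cV[R]_m -> R) (g : 'cV[R]_d -> R) (lambda : R)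
    (w : 'cV[R]_d) : R :=
  n%:R^-1 * (\sum_(i < n) phi i ((A i)^T *m w)) + lambda * g w.

(* Extended-real valued: D(alpha) is -oo when some phi_i^*(-alpha_i) is +oo. *)
Definition dual (R : realType) (n d m : nat) (A : 'I_n -> 'M[R]_(d, m))
    (phi : 'I_n -> 'cV[R]_m -> R) (g : 'cV[R]_d -> R) (lambda : R)
    (alpha : 'I_n -> 'cV[R]_m) : \bar R :=
  (- (lambda%:E * fconj g (alpha_bar A lambda alpha))
   - (n%:R^-1)%:E * \sum_(i < n) fconj (phi i) (- alpha i))%E.

(* The law of a random subset of 'I_n is given by its mass function q. *)

Definition marginal (R : realType) (n : nat) (q : {set 'I_n} -> R)
    (i : 'I_n) : R :=
  \sum_(B : {set 'I_n} | i \in B) q B.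

Definition nice_law (R : realType) (n tau : nat) (B : {set 'I_n}) : R :=
  if #|B| == tau then 'C(n, tau)%:R^-1 else 0.

(* The draws S 0, S 1, ... are mutually independent (product rule over every
   finite family of indices) with common mass function q. *)
Definition iid_draws (R : realType) (disp : measure_display)
    (Omega : measurableType disp) (Pr : probability Omega R) (n : nat)
    (q : {set 'I_n} -> R) (S : nat -> Omega -> {set 'I_n}) : Prop :=
  [/\ forall t B, measurable [set om | S t om = B],
      forall t B, Pr [set om | S t om = B] = (q B)%:E
    & forall (J : seq nat) (E : nat -> {set {set 'I_n}}), uniq J ->
        Pr [set om | forall t, t \in J -> S t om \in E t] =
        (\prod_(t <- J) Pr [set om | S t om \in E t])%E].

Variant quartz_option := OptionI | OptionII.

(* Delta is an admissible increment of coordinate i; a is the current dual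
   block, ab the current average, and w the new primal point. *)
Definition quartz_increment (R : realType) (n d m : nat) (opt : quartz_option)
    (A : 'I_n -> 'M[R]_(d, m)) (phi : 'I_n -> 'cV[R]_m -> R)
    (g : 'cV[R]_d -> R) (lambda theta : R) (p v : 'I_n -> R)
    (i : 'I_n) (a : 'cV[R]_m) (ab w : 'cV[R]_d) (Delta : 'cV[R]_m) : Prop :=
  match opt with
  | OptionI =>
      let obj (D : 'cV[R]_m) : \bar R :=
        (- fconj (phi i) (- (a + D))
         - (edot (grad_fconj g ab) (A i *m D))%:E
         - (v i * enorm D ^+ 2 / (2 * lambda * n%:R))%:E)%E in
      forall D, (obj D <= obj Delta)%E
  | OptionII =>
      Delta = - (theta / p i) *: a
              - (theta / p i) *: grad (phi i) ((A i)^T *m w)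
  end.

(* The range of i is finite, so the infimum is a minimum. *)
Definition quartz_theta (R : realType) (n : nat) (lambda gamma : R)
    (p v : 'I_n -> R) : R :=
  inf [set p i * lambda * gamma * n%:R / (v i + lambda * gamma * n%:R)
      | i in [set: 'I_n]].

(* (w, ab, alpha) is a trajectory of the algorithm along the draws S, where
   S t is the set drawn at iteration t.+1. *)
Definition quartz_run (R : realType) (n d m : nat) (opt : quartz_option)
    (A : 'I_n -> 'M[R]_(d, m)) (phi : 'I_n -> 'cV[R]_m -> R)
    (g : 'cV[R]_d -> R) (lambda gamma : R) (p v : 'I_n -> R)
    (alpha0 : 'I_n -> 'cV[R]_m) (w0 : 'cV[R]_d) (S : nat -> {set 'I_n})
    (w ab : nat -> 'cV[R]_d) (alpha : nat -> 'I_n -> 'cV[R]_m) : Prop :=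
  let theta := quartz_theta lambda gamma p v in
  [/\ w 0%N = w0, alpha 0%N = alpha0, ab 0%N = alpha_bar A lambda alpha0
    & forall t,
      w t.+1 = (1 - theta) *: w t + theta *: grad_fconj g (ab t) /\
      exists Delta : 'I_n -> 'cV[R]_m,
        [/\ forall i, i \notin S t -> alpha t.+1 i = alpha t i,
            forall i, i \in S t -> alpha t.+1 i = alpha t i + Delta i,
            forall i, i \in S t ->
              quartz_increment opt A phi g lambda theta p v i
                (alpha t i) (ab t) (w t.+1) (Delta i)
          & ab t.+1 = ab t
              + (lambda * n%:R)^-1 *: \sum_(i in S t) A i *m Delta i]].

Definition row_degree (R : realType) (n d m : nat) (A : 'I_n -> 'M[R]_(d, m))
    (j : 'I_d) : nat :=
  #|[pred i : 'I_n | row j (A i) != 0]|.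

Definition nice_stepsize (R : realType) (n d m : nat)
    (A : 'I_n -> 'M[R]_(d, m)) (tau : nat) (i : 'I_n) : R :=
  lambda_max (\sum_(j < d)
    (1 + ((row_degree A j)%:R - 1) * (tau%:R - 1) / (n%:R - 1))
      *: ((row j (A i))^T *m row j (A i))).

(* Main.v *)
Require Import Defs.
From HB Require Import structures.
From mathcomp Require Import all_boot all_order all_algebra.
From mathcomp Require Import all_classical all_reals all_analysis.
From mathcomp Require Import measurable_realfun perm ring lra.
Import Order.TTheory GRing.Theory Num.Theory.
Import numFieldNormedType.Exports.
Local Open Scope classical_set_scope.
Local Open Scope ring_scope.

Set Implicit Arguments.
Unset Strict Implicit.
Unset Printing Implicit Defensive.

(* One iteration of Quartz contracts the expected duality gap by 1 - theta.
   The conjugate g^* is 1-smooth, so the expected increase of g^* at the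
   average is at most a linear term plus a quadratic term, and the latter is
   separable over coordinates by the expected separable overapproximation
   (ESO) E |sum_(i in S) A_i h_i|^2 <= sum_i p_i v_i |h_i|^2.  The conjugates
   phi_i^* are gamma-strongly convex, which makes the convex combination
   -(alpha_i + Delta_i) = (1 - theta/p_i) (-alpha_i) + (theta/p_i) u_i with
   u_i = grad phi_i (A_i^T w) pay for that quadratic term exactly when
   theta (v_i + lambda gamma n) <= p_i lambda gamma n; Option I does at least
   as well as this choice (Option II).  The remaining terms are cancelled by
   the convexity inequalities for phi_i and g at the new primal point.  For
   tau-nice sampling the ESO is Cauchy-Schwarz on each row combined with the
   Rayleigh bound for lambda_max, and 1 / theta is at most the factor in front
   of the logarithm. *)

(** * The Euclidean inner product and norm *)

Section Edot.
Context {R : realType} {k : nat}.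
Implicit Types (x y z : 'cV[R]_k) (a : R).

Lemma edotC x y : edot x y = edot y x.
Proof. by apply: eq_bigr => i _; rewrite mulrC. Qed.

Lemma edotDl x y z : edot (x + y) z = edot x z + edot y z.
Proof. by rewrite -big_split; apply: eq_bigr => i _; rewrite mxE mulrDl. Qed.

Lemma edotZl a x y : edot (a *: x) y = a * edot x y.
Proof. by rewrite mulr_sumr; apply: eq_bigr => i _; rewrite mxE mulrA. Qed.

Lemma edotNl x y : edot (- x) y = - edot x y.
Proof. by rewrite -scaleN1r edotZl mulN1r. Qed.

Lemma edotDr x y z : edot z (x + y) = edot z x + edot z y.
Proof. by rewrite edotC edotDl !(edotC z). Qed.

Lemma edotZr a x y : edot y (a *: x) = a * edot y x.
Proof. by rewrite edotC edotZl edotC. Qed.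

Lemma edotNr x y : edot y (- x) = - edot y x.
Proof. by rewrite edotC edotNl edotC. Qed.

Lemma edot0l x : edot 0 x = 0.
Proof. by rewrite -(scale0r 0) edotZl mul0r. Qed.

Lemma edot0r x : edot x 0 = 0.
Proof. by rewrite edotC edot0l. Qed.

Lemma edot_sumr (I : Type) (r : seq I) (P : pred I) (F : I -> 'cV[R]_k) x :
  edot x (\sum_(i <- r | P i) F i) = \sum_(i <- r | P i) edot x (F i).
Proof.
apply: (big_morph (edot x)); last exact: edot0r.
by move=> y z; rewrite edotDr.
Qed.

Lemma edot_ge0 x : 0 <= edot x x.
Proof. by apply: sumr_ge0 => i _; rewrite -expr2 sqr_ge0. Qed.

Lemma edot_eq0 x : (edot x x == 0) = (x == 0).
Proof.
apply/idP/eqP => [|->]; last by rewrite edot0l.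
rewrite psumr_eq0 => [/allP x0|i _]; last by rewrite -expr2 sqr_ge0.
apply/colP => i; have := x0 i (mem_index_enum _).
by rewrite -expr2 sqrf_eq0 mxE => /eqP.
Qed.

Lemma edot_delta x i : edot x (delta_mx i 0) = x i 0.
Proof.
rewrite /edot (bigD1 i)//= mxE !eqxx mulr1 big1 ?addr0// => j ji.
by rewrite mxE (negPf ji) mulr0.
Qed.

Lemma enorm_sqr x : enorm x ^+ 2 = edot x x.
Proof. by rewrite sqr_sqrtr// edot_ge0. Qed.

Lemma enorm_ge0 x : 0 <= enorm x.
Proof. exact: sqrtr_ge0. Qed.

Lemma enormZ a x : 0 <= a -> enorm (a *: x) = a * enorm x.
Proof.
move=> a0; rewrite /enorm edotZl edotZr mulrA sqrtrM ?mulr_ge0//.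
by rewrite -expr2 sqrtr_sqr ger0_norm.
Qed.

Definition edotE := (edotDl, edotDr, edotNl, edotNr, edotZl, edotZr).

(* Expanding [0 <= |b x - a y|^2] with [a = <x,x>], [b = <x,y>]. *)
Lemma edot_CS x y : edot x y ^+ 2 <= edot x x * edot y y.
Proof.
have [->|x0] := eqVneq x 0; first by rewrite !edot0l mul0r expr0n.
have xx : 0 < edot x x by rewrite lt_neqAle edot_ge0 andbT eq_sym edot_eq0.
have := edot_ge0 (edot x y *: x - edot x x *: y).
rewrite !edotE (edotC y x) => h.
have : 0 <= edot x x * (edot x x * edot y y - edot x y ^+ 2).
  by apply: le_trans h _; rewrite le_eqVlt; apply/orP; left; apply/eqP; ring.
by rewrite pmulr_rge0// subr_ge0.
Qed.

Lemma edot_le_enorm x y : edot x y <= enorm x * enorm y.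
Proof.
apply: le_trans (ler_norm _) _.
rewrite -(@ler_pXn2r _ 2%N)// ?nnegrE ?mulr_ge0 ?enorm_ge0//.
by rewrite exprMn !enorm_sqr real_normK ?num_real// edot_CS.
Qed.

End Edot.

Lemma edot_mulmx (R : realType) (d m : nat) (M : 'M[R]_(d, m))
    (x : 'cV[R]_m) (y : 'cV[R]_d) :
  edot y (M *m x) = edot (M^T *m y) x.
Proof.
rewrite /edot; under eq_bigr do rewrite mxE mulr_sumr.
rewrite exchange_big; apply: eq_bigr => j _; rewrite mxE mulr_suml.
by apply: eq_bigr => i _; rewrite mxE mulrA (mulrC (y i 0)).
Qed.

(** * Subgradients of convex functions *)

Section Convex.
Context {R : realType} {k : nat}.
Implicit Types (f g : 'cV[R]_k -> R) (x y u v s : 'cV[R]_k) (a : R).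

(** The library's convexity takes its coefficient in an interval type; here it is a plain real
    number, on which [lra] and [ring] can work. *)
Lemma convex_functionTP f : (forall t x y, 0 <= t <= 1 ->
    f (t *: x + (1 - t) *: y) <= t * f x + (1 - t) * f y) <->
  convex_function setT f.
Proof.
split=> [cf t x y _ _|cf t x y t01].
  by apply: (cf t%:num) => //; rewrite ge0 le1.
have h : Itv.spec (@Itv.num_sem R) (Itv.Real `[0%Z, 1%Z]) t.
  by rewrite /= /Itv.num_sem/= in_itv/= t01 num_real.
by have := cf (Itv.mk h) x y (in_setT _) (in_setT _).
Qed.

(* One Hahn-Banach extension step: the slopes admissible for the new
   coordinate form a nonempty interval because [h] is convex. *)
Lemma convex_minorant_extend f (V : set 'cV[R]_k) s e :
  convex_function setT f -> V 0 ->
  (forall u v a b, 0 <= a -> 0 <= b -> V u -> V v -> V (a *: u + b *: v)) ->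
  (forall v, V v -> edot s v <= f v) ->
  exists c, forall v t, V v -> edot s v + t * c <= f (v + t *: e).
Proof.
move=> /convex_functionTP cf V0 Vc sf.
(* [L] collects the lower bounds on [c] imposed by negative multiples of [e]; [LU] puts each of them
   below every upper bound imposed by a positive multiple. *)
pose L := [set x | exists v r, [/\ V v, 0 < r &
  x = (edot s v - f (v - r *: e)) / r]].
have LU v r u t : V v -> V u -> 0 < r -> 0 < t ->
    (edot s v - f (v - r *: e)) / r <= (f (u + t *: e) - edot s u) / t.
  move=> Vv Vu r0 t0.
  have rt0 : 0 < t + r by rewrite addr_gt0.
  have trI : 0 <= t / (t + r) <= 1.
    by rewrite divr_ge0 ?(ltW t0) ?(ltW rt0)//= ler_pdivrMr// mul1r lerDl ltW.
  (* With these weights the multiples of [e] cancel. *)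
  have := cf (t / (t + r)) (v - r *: e) (u + t *: e) trI.
  have -> : 1 - t / (t + r) = r / (t + r) by field; rewrite gt_eqF.
  have -> : (t / (t + r)) *: (v - r *: e) + (r / (t + r)) *: (u + t *: e) =
      (t / (t + r)) *: v + (r / (t + r)) *: u.
    apply/colP => i; rewrite !mxE; field; by rewrite gt_eqF.
  move=> h.
  have := sf _ (Vc v u (t / (t + r)) (r / (t + r)) _ _ Vv Vu).
  rewrite !divr_ge0 ?(ltW t0) ?(ltW r0) ?(ltW rt0)//.
  move=> /(_ isT isT) /le_trans /(_ h).
  rewrite !edotE !(mulrAC _ (t + r)^-1) -!mulrDl ler_pM2r ?invr_gt0// => h'.
  rewrite ler_pdivrMr// mulrAC ler_pdivlMr//; lra.
exists (sup L) => v t Vv.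
have L0 : L ((edot s 0 - f (0 - 1 *: e)) / 1) by exists 0, 1; split.
have Lub : has_ubound L.
  exists ((f (0 + 1 *: e) - edot s 0) / 1) => _ [u [r [Vu r0 ->]]].
  exact: LU.
have [t0|t0|->] := ltgtP t 0; last by rewrite mul0r scale0r !addr0 sf.
- have : (edot s v - f (v - (- t) *: e)) / (- t) <= sup L.
    by apply: ub_le_sup => //; exists v, (- t); split; rewrite ?oppr_gt0.
  rewrite scaleNr opprK ler_pdivrMr ?oppr_gt0//; lra.
- have : sup L <= (f (v + t *: e) - edot s v) / t.
    apply: ge_sup; first by eexists; exact: L0.
    by move=> _ [u [r [Vu r0 ->]]]; exact: LU.
  rewrite ler_pdivlMr//; lra.
Qed.

(** Finite-dimensional Hahn-Banach: the minorant is extended one coordinate at a time, from the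
    vectors supported on the first [j] coordinates to those supported on the first [j.+1]. *)
Lemma convex_minorant f : convex_function setT f -> 0 <= f 0 ->
  exists s, forall v, edot s v <= f v.
Proof.
move=> cf f0.
suff /(_ k)[s sP] : forall j, exists s, forall v,
    (forall i : 'I_k, (j <= i)%N -> v i 0 = 0) -> edot s v <= f v.
  by exists s => v; apply: sP => i; rewrite leqNgt ltn_ord.
elim=> [|j [s sP]].
  exists 0 => v v0; have -> : v = 0 by apply/colP => i; rewrite v0// mxE.
  by rewrite edot0l.
have [jk|kj] := ltnP j k; last first.
  exists s => v v0; apply: sP => i ji.
  by have := leq_trans kj ji; rewrite leqNgt ltn_ord.
pose o := Ordinal jk.
have [//|||c cP] := @convex_minorant_extend f
    [set v | forall i : 'I_k, (j <= i)%N -> v i 0 = 0] s (delta_mx o 0) cf.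
- by move=> i _; rewrite mxE.
- by move=> u v a b _ _ u0 v0 i ji; rewrite !mxE u0// v0// !mulr0 addr0.
- exact: sP.
(* This replaces coordinate [o] of [s] by the slope [c]. *)
exists (s + (c - s o 0) *: delta_mx o 0) => v v0.
pose v' := v - v o 0 *: delta_mx o 0.
have v'0 (i : 'I_k) : (j <= i)%N -> v' i 0 = 0.
  move=> ji; rewrite !mxE eqxx andbT; case: (eqVneq i o) => [->|io].
    by rewrite mulr1 subrr.
  rewrite mulr0 subr0 v0// ltn_neqAle ji andbT.
  by apply: contra_neq io => ji'; apply/val_inj.
have := cP v' (v o 0) v'0; rewrite subrK; apply: le_trans.
rewrite /v' !edotE [edot (delta_mx _ _) v]edotC !edot_delta; lra.
Qed.

Lemma convex_subgradient f x : convex_function setT f ->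
  exists s, subgradient f x s.
Proof.
move=> /convex_functionTP cf.
have [||s sP] := @convex_minorant (fun v => f (x + v) - f x).
- apply/convex_functionTP => t u v t01.
  have := cf t (x + u) (x + v) t01.
  have -> : t *: (x + u) + (1 - t) *: (x + v) = x + (t *: u + (1 - t) *: v).
    by apply/colP => i; rewrite !mxE; ring.
  lra.
- by rewrite addr0 subrr.
exists s => y; have := sP (y - x); rewrite subrKC; lra.
Qed.

End Convex.

(** * Fenchel conjugates *)

Section Conjugate.
Context {R : realType} {k : nat}.
Implicit Types (f g : 'cV[R]_k -> R) (x y u v s h : 'cV[R]_k) (a b c t : R).

Lemma fconj_ge f u s : ((edot s u - f s)%:E <= fconj f u)%E.
Proof. by apply: ereal_sup_ubound; exists s. Qed.

Lemma fconj_leP f u c :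
  (fconj f u <= c%:E)%E <-> forall s, edot s u - f s <= c.
Proof.
split=> [fc s|fc].
  by rewrite -lee_fin; apply: le_trans fc; exact: fconj_ge.
by apply: ge_ereal_sup => _ [s _ <-]; rewrite lee_fin.
Qed.

Lemma fconj_fin f u c : (fconj f u <= c%:E)%E -> fconj f u \is a fin_num.
Proof.
move=> fc; rewrite fin_real// (le_lt_trans fc) ?ltry// andbT.
exact: lt_le_trans (ltNyr _) (fconj_ge f u 0).
Qed.

Lemma fconj_ltNy f u : (-oo < fconj f u)%E.
Proof. exact: lt_le_trans (ltNyr _) (fconj_ge f u 0). Qed.

Lemma fconj_subgradient f x s :
  subgradient f x s -> fconj f s = (edot x s - f x)%:E.
Proof.
move=> fs; apply/eqP; rewrite eq_le fconj_ge andbT.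
apply/fconj_leP => y; have := fs y.
by rewrite edotDr edotNr !(edotC s); lra.
Qed.

Lemma fenchel_young f x u : fconj f u \is a fin_num ->
  edot x u - f x <= fine (fconj f u).
Proof. by move=> fu; rewrite -lee_fin fineK// fconj_ge. Qed.

(** Reads a derivative off a two-sided quadratic estimate, so that the gradient of g^* is found
    without first proving g^* differentiable. *)
Lemma derive_quadratic_bound f x v c b :
  (forall t, `|f (x + t *: v) - f x - t * c| <= t ^+ 2 * b) ->
  'D_v f x = c.
Proof.
move=> fb; rewrite /derive; apply/cvg_lim => //.
have b0 : 0 <= b.
  by have := fb 1; rewrite expr1n !mul1r; apply: le_trans.
apply/cvgrPdist_le => /= e e0; near=> t.
have t0 : t != 0 by near: t; exact: nbhs_dnbhs_neq.
rewrite [t *: v + x]addrC distrC.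
rewrite (_ : _ - c = t^-1 * (f (x + t *: v) - f x - t * c)); last first.
  by rewrite /GRing.scale/=; field.
rewrite normrM normfV ler_pdivrMl ?normr_gt0//.
apply: le_trans (fb t) _; rewrite -real_normK ?num_real// expr2 -mulrA.
rewrite ler_wpM2l//.
(* Unlike [b], the constant [b + 1] is positive and can be divided by. *)
apply: (@le_trans _ _ (`|t| * (b + 1))); first by rewrite ler_wpM2l// lerDl.
rewrite -ler_pdivlMr ?ltr_wpDl//.
near: t; apply: dnbhs0_le; by rewrite divr_gt0// ltr_wpDl.
Unshelve. all: by end_near. Qed.

(** Strong convexity at 0 bounds <u,x> - g x by <u - s,x> - |x|^2 / 2 - g 0; completing the square
    bounds this by |u - s|^2 / 2 - g 0. *)
Lemma strongly_convex1_conj_fin g : strongly_convex1 g ->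
  forall u, fconj g u \is a fin_num.
Proof.
move=> [cg sg] u; have [s gs] := convex_subgradient 0 cg.
apply: (@fconj_fin _ _ (edot (u - s) (u - s) / 2 - g 0)).
apply/fconj_leP => x; have := sg x 0 s gs.
rewrite subr0 enorm_sqr; have := edot_ge0 (u - s - x).
rewrite !edotE (edotC x u) (edotC x s) (edotC s u); lra.
Qed.

Lemma fine_fconj_convex g : (forall u, fconj g u \is a fin_num) ->
  convex_function setT (fun u => fine (fconj g u)).
Proof.
move=> gfin; apply/convex_functionTP => t u v /andP[t0 t1].
rewrite -lee_fin fineK//; apply/fconj_leP => s.
have := fenchel_young s (gfin u); have := fenchel_young s (gfin v).
move=> /(ler_wpM2l (_ : 0 <= 1 - t)); rewrite subr_ge0 => /(_ t1).
by move=> hv /(ler_wpM2l t0) hu; rewrite !edotE; lra.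
Qed.

(* A subgradient [x] of g^* at [u] satisfies g x = g^**(x), because g has a
   subgradient at [x]. *)
Lemma strongly_convex1_conj_argmax g u : strongly_convex1 g ->
  exists x, subgradient g x u.
Proof.
move=> sg; have gfin := strongly_convex1_conj_fin sg.
have [x xP] := convex_subgradient u (fine_fconj_convex gfin).
exists x => y; have [s /fconj_subgradient sP] := convex_subgradient x sg.1.
have := xP s; rewrite sP/=; have := fenchel_young y (gfin u).
rewrite !edotE (edotC u) (edotC u); lra.
Qed.

(** * Smoothness of the conjugate of a strongly convex function *)

Section StronglyConvexConj.
Variables (g : 'cV[R]_k -> R) (sg : strongly_convex1 g).
Let G u := fine (fconj g u).

(** The lower bound is Fenchel-Young at [u + h], tested at [x]. The upper bound combines strong
    convexity of g at [x] with |y - x - h|^2 >= 0. *)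
Let conj_smooth_at u x h : subgradient g x u ->
  edot x h <= G (u + h) - G u <= edot x h + edot h h / 2.
Proof.
move=> gu; rewrite /G (fconj_subgradient gu)/=.
have := fenchel_young x (strongly_convex1_conj_fin sg (u + h)).
rewrite edotDr => h1; apply/andP; split; first lra.
suff : fine (fconj g (u + h)) <= edot x u - g x + edot x h + edot h h / 2 by lra.
rewrite -lee_fin fineK ?strongly_convex1_conj_fin//; apply/fconj_leP => y.
have := sg.2 y x u gu; rewrite enorm_sqr; have := edot_ge0 (y - x - h).
rewrite !edotE (edotC y x) !(edotC u) !(edotC h); lra.
Qed.

Lemma grad_fconjP u x : subgradient g x u -> grad_fconj g u = x.
Proof.
move=> gu; apply/colP => i; rewrite mxE.
apply: (@derive_quadratic_bound _ _ _ _ 1) => t.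
have /andP[] := conj_smooth_at (t *: delta_mx i 0) gu.
rewrite !edotE !edot_delta mxE !eqxx /G /= => h1 h2.
by rewrite ger0_norm; have := sqr_ge0 t; lra.
Qed.

Lemma subgradient_grad_fconj u : subgradient g (grad_fconj g u) u.
Proof.
have [x gx] := strongly_convex1_conj_argmax u sg.
by rewrite (grad_fconjP gx).
Qed.

Lemma fconj_smooth u h :
  G (u + h) <= G u + edot (grad_fconj g u) h + edot h h / 2.
Proof.
by have /andP[_] := conj_smooth_at h (subgradient_grad_fconj u); lra.
Qed.

End StronglyConvexConj.

(** * Differentiable functions: gradient inequality and descent lemma *)

Section Smooth.
Variables (f : 'cV[R]_k -> R) (df : forall x, differentiable f x).

Lemma edot_grad x v : 'D_v f x = edot (grad f x) v.
Proof.
have -> : v = \sum_i v i 0 *: delta_mx i 0.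
  by rewrite [LHS]matrix_sum_delta; apply: eq_bigr => i _; rewrite big_ord1.
rewrite edot_sumr deriveE// linear_sum; apply: eq_bigr => i _.
by rewrite linearZ/= edotZr edot_delta mxE deriveE.
Qed.

(** By convexity the difference quotient from [x] towards [y] over a step 0 < t <= 1 is at most f y
    - f x; let t decrease to 0. *)
Lemma convex_grad x : convex_function setT f -> subgradient f x (grad f x).
Proof.
move=> /convex_functionTP cf y; rewrite -edot_grad -lerBrDl.
have dfx : derivable f x (y - x) by exact: diff_derivable.
rewrite /derive cvg_at_rightE//; apply: limr_le.
  by apply/cvg_ex; exists ('D_(y - x) f x); exact: cvg_dnbhs_at_right.
near=> t; have t0 : 0 < t by [].
rewrite /= /GRing.scale/= ler_pdivrMl//.
have t1 : 0 <= t <= 1.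
  by rewrite ltW//=; near: t; exact: nbhs_right_le.
have := cf t y x t1.
rewrite (_ : t *: y + _ = t *: (y - x) + x); first by lra.
by apply/colP => i; rewrite !mxE; ring.
Unshelve. all: by end_near. Qed.

(** The mean value theorem for [psi], which is f along the segment minus the linear and quadratic
    terms: the Lipschitz bound makes its derivative nonpositive, so psi 1 <= psi 0. *)
Lemma descent (gamma : R) x v : 0 < gamma ->
  (forall x y, enorm (grad f x - grad f y) <= gamma^-1 * enorm (x - y)) ->
  f (x + v) <= f x + edot (grad f x) v + edot v v / (2 * gamma).
Proof.
move=> g0 lf; pose s := edot (grad f x) v; pose q := edot v v / (2 * gamma).
pose psi (t : R) : R := f (x + t *: v) - (t * s + t ^+ 2 * q).
pose dpsi (t : R) : R := edot (grad f (x + t *: v)) v - (s + 2 * t * q).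
have Df (t : R) : is_derive t 1 (fun t : R => f (x + t *: v))
    (edot (grad f (x + t *: v)) v).
  have E : (fun h : R => h^-1 *: (((fun t : R => f (x + t *: v)) \o shift t)
      (h *: 1) - f (x + t *: v))) = (fun h : R => h^-1 *:
      ((f \o shift (x + t *: v)) (h *: v) - f (x + t *: v))).
    apply/funext => h /=; congr (_ *: (f _ - _)).
    by rewrite scalerDl addrCA /GRing.scale/= mulr1.
  split; first by rewrite /derivable E; exact: diff_derivable.
  by rewrite /derive E -[RHS]edot_grad.
have Dpsi (t : R) : is_derive t 1 psi (dpsi t).
  rewrite /psi /dpsi; apply: is_deriveB; apply: is_derive_eq.
  rewrite /GRing.scale/=; ring.
have [|c] := @MVT R psi dpsi 0 1 ltr01 (fun t _ => Dpsi t).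
  by apply: derivable_within_continuous => t _; have [] := Dpsi t.
rewrite in_itv/= => /andP[c0 _].
rewrite /psi scale1r scale0r !addr0 mul0r expr0n mul0r expr1n !mul1r => h.
suff : dpsi c <= 0 by rewrite /s /q in h *; lra.
have := edot_le_enorm (grad f (x + c *: v) - grad f x) v.
have := lf (x + c *: v) x.
rewrite addrAC subrr add0r enormZ ?(ltW c0)// => h1 h2.
have {h1 h2} : edot (grad f (x + c *: v) - grad f x) v <=
    gamma^-1 * (c * enorm v) * enorm v.
  by apply: le_trans h2 _; rewrite ler_wpM2r// enorm_ge0.
rewrite /dpsi /q -enorm_sqr edotDl edotNl -/s.
have -> : 2 * c * (enorm v ^+ 2 / (2 * gamma)) = gamma^-1 * (c * enorm v) * enorm v.
  by field; rewrite gt_eqF.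
lra.
Qed.
End Smooth.

(* For each [z], test the two conjugates at the points [z + gamma (1 - t) e]
   and [z - gamma t e], whose average is [z]. *)
Lemma fconj_strongly_convex f (gamma : R) t s1 s2 c1 c2 : 0 < gamma ->
  (forall x, exists s, forall v,
     f (x + v) <= f x + edot s v + edot v v / (2 * gamma)) ->
  0 <= t <= 1 -> (fconj f s1 <= c1%:E)%E -> (fconj f s2 <= c2%:E)%E ->
  (fconj f (t *: s1 + (1 - t) *: s2) <=
   (t * c1 + (1 - t) * c2
    - gamma * t * (1 - t) / 2 * edot (s1 - s2) (s1 - s2))%:E)%E.
Proof.
move=> g0 fD /andP[t0 t1] /fconj_leP fs1 /fconj_leP fs2.
apply/fconj_leP => z; have [s sP] := fD z; have [e eE] : exists e, e = s1 - s2 by exists (s1 - s2).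
have {}t1 : 0 <= 1 - t by rewrite subr_ge0.
have h1 := fs1 (z + (gamma * (1 - t)) *: e).
have h2 := fs2 (z + (- (gamma * t)) *: e).
have h3 := sP ((gamma * (1 - t)) *: e).
have h4 := sP ((- (gamma * t)) *: e).
(* Weighted by t and 1 - t, the terms in [s] cancel; those in [s1] and [s2] contribute gamma t (1 -
   t) |e|^2, of which the quadratic errors take back half. *)
have {h1 h3} := lerD (ler_wpM2l t0 h1) (ler_wpM2l t0 h3).
have {h2 h4} := lerD (ler_wpM2l t1 h2) (ler_wpM2l t1 h4).
rewrite -eE !edotE; set ee := edot e e; set se := edot s e.
have -> : gamma * (1 - t) * (gamma * (1 - t) * ee) / (2 * gamma) =
  gamma * (1 - t) ^+ 2 * ee / 2 by field; rewrite gt_eqF.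
have -> : - (gamma * t) * (- (gamma * t) * ee) / (2 * gamma) =
  gamma * t ^+ 2 * ee / 2 by field; rewrite gt_eqF.
have : ee = edot e s1 - edot e s2 by rewrite /ee {2}eE !edotE.
move: (edot e s1) (edot e s2) => e1 e2 ->. lra.
Qed.
End Conjugate.

(** * The largest eigenvalue *)

Section LambdaMax.
Context {R : realType} {k : nat}.
Implicit Types (M B : 'M[R]_k) (x y : 'cV[R]_k).

Lemma qform_bound M : exists2 K, 0 < K &
  forall x, edot x (M *m x) <= K * edot x x.
Proof.
(* The summand 1 makes the constant positive. *)
exists (1 + \sum_i \sum_j `|M i j|).
  by rewrite ltr_pwDl// sumr_ge0// => i _; apply: sumr_ge0.
move=> x; rewrite mulrDl mul1r ler_wpDl ?edot_ge0// {1}/edot mulr_suml.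
apply: ler_sum => i _; rewrite mxE mulr_sumr mulr_suml.
apply: ler_sum => j _; rewrite mulrCA (le_trans (ler_norm _))// normrM.
rewrite ler_wpM2l//.
have xi (l : 'I_k) : x l 0 ^+ 2 <= edot x x.
  rewrite /edot (bigD1 l)//= -expr2 lerDl; apply: sumr_ge0 => o _.
  by rewrite -expr2 sqr_ge0.
have := xi i; have := xi j; have := sqr_ge0 (`|x i 0| - `|x j 0|).
rewrite normrM -[x i 0 ^+ 2]real_normK ?num_real//.
rewrite -[x j 0 ^+ 2]real_normK ?num_real//; nra.
Qed.

Lemma psd_CS B x y : B^T = B -> (forall z, 0 <= edot z (B *m z)) ->
  edot y (B *m x) ^+ 2 <= edot x (B *m x) * edot y (B *m y).
Proof.
move=> sB pB; set a := edot x _; set b := edot y (B *m x); set c := edot y _.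
have sym : edot x (B *m y) = b by rewrite edot_mulmx sB edotC.
have h t u : 0 <= t ^+ 2 * a - 2 * t * u * b + u ^+ 2 * c.
  have := pB (t *: x - u *: y).
  rewrite mulmxBr -!scalemxAr !edotE sym -/a -/b -/c; lra.
have [a0|a0] := eqVneq a 0.
  rewrite a0 mul0r; have : 0 <= c by exact: pB.
  (* For a = 0 this instance reads 0 <= - b^2 (c + 2), which forces b = 0. *)
  by have := h (c + 1) b; rewrite a0; nra.
have {}a0 : 0 < a by rewrite lt_neqAle eq_sym a0; exact: pB.
by have := h b a; nra.
Qed.

(** [psd_CS] with y = B x gives |B x|^4 <= <x,B x> K |B x|^2, hence |B x|^2 <= K <x,B x>;
    invertibility bounds |x|^2 by L |B x|^2. *)
Lemma psd_unit_coercive B : B^T = B -> (forall z, 0 <= edot z (B *m z)) ->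
  B \in unitmx -> exists2 C, 0 < C &
    forall x, edot x x <= C * edot x (B *m x).
Proof.
move=> sB pB uB.
have [K K0 KP] := qform_bound B.
have [L L0 LP] := qform_bound ((invmx B)^T *m invmx B).
exists (L * K); first exact: mulr_gt0.
move=> x; rewrite -mulrA; apply: (@le_trans _ _ (L * edot (B *m x) (B *m x))).
  apply: le_trans (LP _).
  by rewrite -mulmxA edot_mulmx trmxK mulmxA mulVmx// mul1mx.
rewrite ler_pM2l//.
have [->|Bx0] := eqVneq (B *m x) 0.
  by rewrite !edot0r mulr0.
have Bx : 0 < edot (B *m x) (B *m x).
  by rewrite lt_neqAle edot_ge0 andbT eq_sym edot_eq0.
rewrite -(ler_pM2r Bx) -expr2; apply: le_trans (psd_CS x (B *m x) sB pB) _.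
by rewrite mulrAC mulrC ler_wpM2r ?pB.
Qed.

(* With [mu] the supremum of the quadratic form on the unit sphere, [mu I - M]
   is positive semidefinite but not coercive, hence singular. *)
Lemma lambda_max_rayleigh M x : M^T = M ->
  edot x (M *m x) <= lambda_max M * edot x x.
Proof.
move=> sM; have [->|x0] := eqVneq x 0; first by rewrite !edot0l mulr0.
have [K K0 KP] := qform_bound M.
pose Q := [set edot z (M *m z) | z in [set z | edot z z = 1]].
have norm1 z : z != 0 -> edot ((enorm z)^-1 *: z) ((enorm z)^-1 *: z) = 1.
  rewrite -edot_eq0 => z0; rewrite !edotE mulrA -expr2 exprVn enorm_sqr.
  by rewrite mulVf.
have Q0 : Q !=set0.
  by eexists; exists ((enorm x)^-1 *: x) => //=; exact: norm1.
have Qub : has_ubound Q.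
  by exists K => _ [z /= z1 <-]; rewrite -[leRHS]mulr1 -z1.
pose mu := sup Q.
have muP z : edot z (M *m z) <= mu * edot z z.
  have [->|z0] := eqVneq z 0; first by rewrite !edot0l mulr0.
  have : edot ((enorm z)^-1 *: z) (M *m ((enorm z)^-1 *: z)) <= mu.
    by apply: ub_le_sup => //; exists ((enorm z)^-1 *: z) => //=; exact: norm1.
  rewrite -scalemxAr edotZl edotZr mulrA -expr2 exprVn enorm_sqr.
  by rewrite ler_pdivrMl ?lt_neqAle ?edot_ge0 ?andbT 1?eq_sym ?edot_eq0// mulrC.
have emu : eigenvalue M mu.
  (* If [mu] were no eigenvalue, [mu%:M - M] would be coercive, and [mu - C^-1] would already bound
     the form on the unit sphere. *)
  apply: contraT; rewrite /eigenvalue/= /eigenspace.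
  rewrite negbK kermx_eq0 row_free_unit => uM.
  have uB : mu%:M - M \in unitmx by rewrite -opprB -scaleN1r unitmxZ ?unitrN1.
  have BE z : edot z ((mu%:M - M) *m z) = mu * edot z z - edot z (M *m z).
    by rewrite mulmxBl mul_scalar_mx !edotE.
  have [|z|C C0 CP] := psd_unit_coercive _ _ uB.
  - by rewrite linearB/= tr_scalar_mx sM.
  - by rewrite BE subr_ge0.
  have Ci : 0 < C^-1 by rewrite invr_gt0.
  suff : mu <= mu - C^-1 by lra.
  apply: ge_sup => // _ [z /= z1 <-].
  have := CP z; rewrite BE z1 mulr1 -ler_pdivrMl// mulr1; lra.
apply: le_trans (muP x) _; rewrite ler_wpM2r ?edot_ge0//.
(* [lambda_max] is a supremum, so the spectrum has to be bounded above. Eigenvectors are row vectors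
   here, hence the transpose. *)
apply: ub_le_sup => //; exists K => a /= /eigenvalueP[v vM v0].
have vx : M *m v^T = a *: v^T by rewrite -{1}sM -trmx_mul vM linearZ.
have := KP v^T; rewrite vx edotZr ler_pM2r//.
by rewrite lt_neqAle edot_ge0 andbT eq_sym edot_eq0 trmx_eq0.
Qed.

End LambdaMax.

(** * Nice sampling *)

Section NiceSampling.
Context {R : realType} {n tau : nat}.
Hypothesis taun : (1 <= tau <= n)%N.
Local Notation q := (@nice_law R n tau).

Lemma nice_law_ge0 B : 0 <= q B.
Proof. by rewrite /nice_law; case: ifP. Qed.

Lemma nice_law_sum1 : \sum_B q B = 1.
Proof.
rewrite /nice_law -big_mkcond/= sumr_const.
have := card_draws 'I_n tau; rewrite cardsE card_ord => ->.
rewrite -[LHS]mulr_natl mulfV// pnatr_eq0 -lt0n bin_gt0.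
by case/andP: taun.
Qed.

Lemma nice_law_card (F : nat -> R) : \sum_B q B * F #|B| = F tau.
Proof.
rewrite -[RHS]mul1r -nice_law_sum1 mulr_suml; apply: eq_bigr => B _.
by rewrite /nice_law; case: eqP => [->|]; rewrite ?mul0r.
Qed.

(** The probability that [i] and [k] are both drawn; on the diagonal it is the marginal. *)
Let c i k := \sum_(B : {set 'I_n} | (i \in B) && (k \in B)) q B.

Let c_perm (s : {perm 'I_n}) i k : c (s i) (s k) = c i k.
Proof.
rewrite /c (reindex_inj (imset_inj (@perm_inj _ s))).
apply: eq_big => [B|B _]; first by rewrite !(mem_imset _ _ perm_inj).
by rewrite /nice_law card_imset//; exact: perm_inj.
Qed.

Let sum_c (F : 'I_n -> 'I_n -> R) :
  \sum_B q B * (\sum_(i in B) \sum_(k in B) F i k) =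
  \sum_i \sum_k c i k * F i k.
Proof.
under eq_bigr do rewrite mulr_sumr big_mkcond/=.
rewrite exchange_big; apply: eq_bigr => i _.
rewrite -big_mkcond/=; under eq_bigr do rewrite mulr_sumr big_mkcond/=.
rewrite exchange_big; apply: eq_bigr => k _.
by rewrite -big_mkcondr/= mulr_suml.
Qed.

(** Transpositions show that all marginals agree, and they add up to the expected cardinality
    [tau]. *)
Lemma marginal_nice i : marginal q i = tau%:R / n%:R.
Proof.
have mE k : marginal q k = c k k by apply: eq_bigl => B; rewrite andbb.
have mi k : marginal q k = marginal q i.
  by rewrite !mE -(c_perm (tperm k i)) tpermL.
have : \sum_k marginal q k = tau%:R.
  rewrite -(nice_law_card (fun m => m%:R)) /marginal.
  under eq_bigr do rewrite big_mkcond/=.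
  rewrite exchange_big; apply: eq_bigr => B _.
  by rewrite -big_mkcond/= sumr_const mulr_natr.
under eq_bigr do rewrite mi; rewrite sumr_const card_ord -[X in X = _]mulr_natr => <-.
by rewrite mulfK// pnatr_eq0 -lt0n (leq_ltn_trans _ (ltn_ord i)).
Qed.

Hypothesis n2 : (2 <= n)%N.

(* The law is invariant under permutations, so [c i k] is the same for all
   [i != k], and [E |S|^2 = tau^2] determines the common value. *)
Let c_neq i k : i != k ->
  c i k = (tau%:R * (tau%:R - 1)) / (n%:R * (n%:R - 1)).
Proof.
move=> ik.
have cE i' k' : i' != k' -> c i' k' = c i k.
  (* A first transposition moves [i'] to [i] and [k'] to some [k1]; a second moves [k1] to [k] and
     fixes [i], which differs from both. *)
  move=> ik'; rewrite -(c_perm (tperm i' i)) tpermL.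
  set k1 := tperm i' i k'.
  have k1i : k1 != i by rewrite -(tpermL i' i) (inj_eq perm_inj) eq_sym.
  by rewrite -(c_perm (tperm k1 k)) tpermL tpermD// eq_sym.
have n0 : n%:R != 0 :> R by rewrite pnatr_eq0 -lt0n ltnW.
have n1 : n%:R - 1 != 0 :> R.
  by rewrite subr_eq0 pnatr_eq1 neq_ltn n2 orbT.
have := sum_c (fun _ _ => 1).
under eq_bigr do rewrite !sumr_const -[X in _ * X]mulr_natr.
rewrite (nice_law_card (fun m => m%:R * m%:R)) => h.
have {h} : tau%:R * tau%:R = \sum_(i' < n) (tau%:R / n%:R + (n%:R - 1) * c i k).
  rewrite h; apply: eq_bigr => i' _; rewrite (bigD1 i')//= mulr1; congr (_ + _).
    by rewrite -(marginal_nice i'); apply: eq_bigl => B; rewrite andbb.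
  under eq_bigr => k' k'i do rewrite mulr1 cE 1?eq_sym//.
  rewrite sumr_const (_ : #|_| = n.-1); last first.
    by rewrite cardC1 card_ord.
  by rewrite -[LHS]mulr_natl -subn1 natrB// ltnW.
rewrite sumr_const card_ord -[X in _ = X]mulr_natl => h.
have : c i k * (n%:R * (n%:R - 1)) = tau%:R * (tau%:R - 1).
  have -> : tau%:R * (tau%:R - 1) = tau%:R * tau%:R - tau%:R :> R by ring.
  rewrite h; field; exact: n0.
by move=> <-; rewrite mulfK// mulf_neq0.
Qed.

(** Expanding the square, diagonal pairs have weight tau / n and the others tau (tau - 1) / (n (n -
    1)); the right side regroups the latter into a full square. *)
Lemma nice_second_moment (x : 'I_n -> R) :
  \sum_B q B * (\sum_(i in B) x i) ^+ 2 =
  tau%:R / n%:R * ((1 - (tau%:R - 1) / (n%:R - 1)) * \sum_i x i ^+ 2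
    + (tau%:R - 1) / (n%:R - 1) * (\sum_i x i) ^+ 2).
Proof.
have n0 : n%:R != 0 :> R by rewrite pnatr_eq0 -lt0n ltnW.
have n1 : n%:R - 1 != 0 :> R.
  by rewrite subr_eq0 pnatr_eq1 neq_ltn n2 orbT.
transitivity (\sum_i \sum_k c i k * (x i * x k)).
  rewrite -sum_c; apply: eq_bigr => B _; congr (_ * _).
  by rewrite expr2 mulr_suml; apply: eq_bigr => i _; rewrite mulr_sumr.
rewrite [in RHS]expr2 mulr_suml mulrDr !mulr_sumr -big_split/=.
apply: eq_bigr => i _; rewrite mulr_sumr !mulr_sumr.
rewrite (bigD1 i)//= [in RHS](bigD1 i)//= addrA; congr (_ + _).
  have -> : c i i = tau%:R / n%:R.
    by rewrite -(marginal_nice i); apply: eq_bigl => B; rewrite andbb.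
  by field; rewrite n0 n1.
apply: eq_bigr => k ki; rewrite c_neq 1?eq_sym//.
by field; rewrite n0 n1.
Qed.

(** Cauchy-Schwarz against the indicator vector of [J]. *)
Lemma sqr_sum_support (x : 'I_n -> R) (J : pred 'I_n) :
  (forall i, ~~ J i -> x i = 0) ->
  (\sum_i x i) ^+ 2 <= #|J|%:R * \sum_i x i ^+ 2.
Proof.
move=> x0; have := edot_CS (\col_i (J i)%:R : 'cV[R]_n) (\col_i x i).
rewrite /edot; under eq_bigr do rewrite !mxE.
rewrite (eq_bigr x) => [|i _]; last first.
  by case: (boolP (J i)) => Ji; rewrite ?mul1r// mul0r x0.
move=> /le_trans; apply; rewrite le_eqVlt; apply/orP; left; apply/eqP.
congr (_ * _); last by apply: eq_bigr => i _; rewrite mxE expr2.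
rewrite -sum1_card natr_sum [RHS]big_mkcond/=; apply: eq_bigr => i _.
by rewrite !mxE unfold_in; case: (J i); rewrite ?mulr1// mulr0.
Qed.

Variables (d m : nat) (A : 'I_n -> 'M[R]_(d, m)).

Let weight (j : 'I_d) : R :=
  1 + ((row_degree A j)%:R - 1) * (tau%:R - 1) / (n%:R - 1).

Let nice_qform i (x : 'cV[R]_m) :
  edot x ((\sum_j weight j *: ((row j (A i))^T *m row j (A i))) *m x) =
  \sum_j weight j * ((A i *m x) j 0) ^+ 2.
Proof.
rewrite mulmx_suml edot_sumr; apply: eq_bigr => j _.
rewrite -scalemxAl edotZr -mulmxA edot_mulmx trmxK -row_mul; congr (_ * _).
by rewrite /edot big_ord1 mxE expr2.
Qed.

Lemma nice_stepsize_rayleigh i (x : 'cV[R]_m) :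
  \sum_j weight j * ((A i *m x) j 0) ^+ 2 <=
  nice_stepsize A tau i * edot x x.
Proof.
rewrite -nice_qform lambda_max_rayleigh// linear_sum/=; apply: eq_bigr => j _.
by rewrite linearZ/= trmx_mul trmxK.
Qed.

(** A nonzero matrix has a column, hence there is a nonzero vector on which to test the Rayleigh
    bound. *)
Lemma nice_stepsize_ge0 i : A i != 0 -> 0 <= nice_stepsize A tau i.
Proof.
move=> A0; have [t1 _] := andP taun.
have [l /eqP x0] : exists l, delta_mx l 0 != 0 :> 'cV[R]_m.
  case: (pickP (fun l : 'I_m => true)) => [l _|m0].
    exists l; apply/eqP => /colP/(_ l); rewrite !mxE !eqxx => /eqP.
    by rewrite oner_eq0.
  by move/eqP: A0; case; apply/matrixP => j l; have := m0 l.
have xx : 0 < edot (delta_mx l 0) (delta_mx l 0) :> R.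
  by rewrite lt_neqAle edot_ge0 andbT eq_sym edot_eq0; apply/eqP.
rewrite -(pmulr_lge0 _ xx); apply: le_trans _ (nice_stepsize_rayleigh i _).
have n1 : 0 < n%:R - 1 :> R by rewrite subr_gt0 ltr1n.
(* If row [j] of [A i] vanishes, so does the term; otherwise [i] itself witnesses that
   [row_degree A j] is at least 1. *)
apply: sumr_ge0 => j _; have [r0|r0] := eqVneq (row j (A i)) 0.
  have := row_mul j (A i) (delta_mx l 0 : 'cV_m).
  rewrite r0 mul0mx => /rowP/(_ 0); rewrite [LHS]mxE [RHS]mxE => ->.
  by rewrite expr0n mulr0.
apply: mulr_ge0; last exact: sqr_ge0.
rewrite addr_ge0// divr_ge0 ?(ltW n1)// mulr_ge0 ?subr_ge0 ?ler1n//.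
by apply/card_gt0P; exists i.
Qed.

Lemma nice_eso (h : 'I_n -> 'cV[R]_m) :
  \sum_B q B * edot (\sum_(i in B) A i *m h i) (\sum_(i in B) A i *m h i) <=
  \sum_i marginal q i * nice_stepsize A tau i * edot (h i) (h i).
Proof.
have [t1 tn] := andP taun.
have n1 : 0 < n%:R - 1 :> R by rewrite subr_gt0 ltr1n.
have tn0 : 0 <= (tau%:R - 1) / (n%:R - 1) :> R.
  by rewrite divr_ge0 ?(ltW n1)// subr_ge0 ler1n.
pose x i j := (A i *m h i) j 0.
rewrite (eq_bigr (fun B => \sum_j q B * (\sum_(i in B) x i j) ^+ 2)); last first.
  move=> B _; rewrite /edot mulr_sumr; apply: eq_bigr => j _.
  by rewrite summxE -expr2.
rewrite exchange_big/=; under eq_bigr do rewrite nice_second_moment.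
apply: (@le_trans _ _ (\sum_j \sum_i tau%:R / n%:R * (weight j * x i j ^+ 2))).
  apply: ler_sum => j _; rewrite -!mulr_sumr ler_wpM2l ?divr_ge0//.
  have x0 i : ~~ (row j (A i) != 0) -> x i j = 0.
    move=> /negPn/eqP r0; rewrite /x -[LHS](_ : row j (A i *m h i) 0 0 = _).
      by rewrite row_mul r0 mul0mx mxE.
    by rewrite mxE.
  (* With beta = (tau - 1) / (n - 1), this turns the coefficient of the sum of squares into 1 - beta
     + beta omega_j, which is [weight j]. *)
  have /(ler_wpM2l tn0) := sqr_sum_support (J := [pred i | row j (A i) != 0]) x0.
  rewrite /weight /row_degree.
  move: (\sum_(i < n) x i j ^+ 2) (_%:R) => s2 w.
  lra.
rewrite exchange_big/=; apply: ler_sum => i _.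
rewrite -mulr_sumr marginal_nice -mulrA ler_wpM2l ?divr_ge0//.
exact: nice_stepsize_rayleigh.
Qed.

End NiceSampling.

(** * The contraction of the expected gap *)

Section Gap.
Context {R : realType} {n d m : nat}.
Variables (phi : 'I_n -> 'cV[R]_m -> R) (g : 'cV[R]_d -> R).
Variables (A : 'I_n -> 'M[R]_(d, m)) (lambda : R).
Hypotheses (n0 : (0 < n)%N) (l0 : 0 < lambda) (sg : strongly_convex1 g).

Definition dual_dom (alpha : 'I_n -> 'cV[R]_m) : Prop :=
  forall i, fconj (phi i) (- alpha i) \is a fin_num.

(** The duality gap as a real number. [fine] sends infinite values to 0, so the formula is
    meaningful on [dual_dom]. *)
Definition gap (w : 'cV[R]_d) (alpha : 'I_n -> 'cV[R]_m) : R :=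
  primal A phi g lambda w + lambda * fine (fconj g (alpha_bar A lambda alpha))
  + n%:R^-1 * \sum_i fine (fconj (phi i) (- alpha i)).

Lemma gapE w alpha : dual_dom alpha ->
  ((primal A phi g lambda w)%:E - dual A phi g lambda alpha)%E =
  (gap w alpha)%:E.
Proof.
move=> da; rewrite /dual -(fineK (strongly_convex1_conj_fin sg _)).
rewrite (eq_bigr (fun i => (fine (fconj (phi i) (- alpha i)))%:E)); last first.
  by move=> i _; rewrite fineK.
rewrite sumEFin -!EFinM -!EFinN -!EFinD; congr EFin.
by rewrite /gap; lra.
Qed.

(** No conjugate takes the value -oo, so a single +oo makes the whole gap +oo. *)
Lemma dual_domP w alpha :
  ((primal A phi g lambda w)%:E - dual A phi g lambda alpha < +oo)%E ->
  dual_dom alpha.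
Proof.
rewrite /dual -(fineK (strongly_convex1_conj_fin sg _)) => h i.
rewrite fin_real// fconj_ltNy ltNge leye_eq; apply/negP => /eqP fi.
move: h; have -> : (\sum_i fconj (phi i) (- alpha i) = +oo)%E.
  apply/eqP; rewrite esum_eqy; last first.
    by move=> j _; rewrite gt_eqF// fconj_ltNy.
  by apply/existsP; exists i; rewrite fi.
by rewrite gt0_muley ?lte_fin ?invr_gt0 ?ltr0n.
Qed.

(** Weak duality: Fenchel-Young for g and for each phi_i; the inner products cancel by the
    definition of [alpha_bar]. *)
Lemma gap_ge0 w alpha : dual_dom alpha -> 0 <= gap w alpha.
Proof.
move=> da; have N0 : n%:R != 0 :> R by rewrite pnatr_eq0 -lt0n.
have gY := fenchel_young w (strongly_convex1_conj_fin sg (alpha_bar A lambda alpha)).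
have : lambda * edot w (alpha_bar A lambda alpha) =
    n%:R^-1 * \sum_i edot w (A i *m alpha i).
  rewrite edotZr edot_sumr mulrA; congr (_ * _); field.
  by rewrite N0 gt_eqF.
have : n%:R^-1 * \sum_i (- edot w (A i *m alpha i)) <= n%:R^-1 *
    \sum_i (phi i ((A i)^T *m w) + fine (fconj (phi i) (- alpha i))).
  rewrite ler_wpM2l ?invr_ge0//; apply: ler_sum => i _.
  have := fenchel_young ((A i)^T *m w) (da i).
  by rewrite edotNr edot_mulmx; lra.
rewrite sumrN big_split/= mulrDr mulrN /gap /primal.
move: (n%:R^-1 * _) => X h1 h2; have := ler_wpM2l (ltW l0) gY.
by rewrite mulrBr h2; lra.
Qed.

End Gap.

(** * The update of a single dual block *)

Section Increment.
Context {R : realType} {n d m : nat}.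
Variables (phi : 'I_n -> 'cV[R]_m -> R) (g : 'cV[R]_d -> R).
Variables (A : 'I_n -> 'M[R]_(d, m)) (gamma lambda theta : R).
Variables (p v : 'I_n -> R) (opt : quartz_option).
Hypotheses (n0 : (0 < n)%N) (gam0 : 0 < gamma) (l0 : 0 < lambda).
Hypotheses (cphi : forall i, convex_function setT (phi i))
  (dphi : forall i x, differentiable (phi i) x)
  (lphi : forall i x y,
     enorm (grad (phi i) x - grad (phi i) y) <= gamma^-1 * enorm (x - y)).
Hypotheses (p0 : forall i, 0 < p i) (v0 : forall i, 0 <= v i).
Hypotheses (th0 : 0 <= theta)
  (thP : forall i, theta * (v i + lambda * gamma * n%:R) <=
                   p i * (lambda * gamma * n%:R)).

Let lgn0 : 0 < lambda * gamma * n%:R.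
Proof. by rewrite !mulr_gt0// ltr0n. Qed.

Lemma theta_le_marginal i : theta <= p i.
Proof.
rewrite -(ler_pM2r lgn0); apply: le_trans (thP i).
by rewrite ler_wpM2l// lerDr.
Qed.

Let sconj i t s1 s2 c1 c2 : 0 <= t <= 1 ->
  (fconj (phi i) s1 <= c1%:E)%E -> (fconj (phi i) s2 <= c2%:E)%E ->
  (fconj (phi i) (t *: s1 + (1 - t) *: s2) <=
   (t * c1 + (1 - t) * c2
    - gamma * t * (1 - t) / 2 * edot (s1 - s2) (s1 - s2))%:E)%E.
Proof.
apply: fconj_strongly_convex => // x; exists (grad (phi i) x) => y.
by apply: descent => //; exact: lphi.
Qed.

Section Bound.
Variables (i : 'I_n) (a : 'cV[R]_m) (ab w : 'cV[R]_d) (c : R).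
Hypothesis ac : (fconj (phi i) (- a) <= c%:E)%E.
Let x := (A i)^T *m w.
Let u := grad (phi i) x.
Let k := theta / p i.
(* [D0] is the increment of Option II. *)
Let D0 := - k *: (a + u).

Let increment0_bound : (fconj (phi i) (- (a + D0)) <=
  (k * (edot x u - phi i x) + (1 - k) * c
   - v i * edot D0 D0 / (2 * lambda * n%:R))%:E)%E.
Proof.
have N0 : 0 < n%:R :> R by rewrite ltr0n.
have k01 : 0 <= k <= 1.
  by rewrite divr_ge0 ?(ltW (p0 i))//= ler_pdivrMr// mul1r theta_le_marginal.
have -> : - (a + D0) = k *: u + (1 - k) *: (- a).
  by apply/colP => j; rewrite !mxE; ring.
have uc : (fconj (phi i) u <= (edot x u - phi i x)%:E)%E.
  by rewrite (fconj_subgradient (convex_grad (dphi i) x (cphi i))).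
apply: le_trans (sconj k01 uc ac) _; rewrite lee_fin.
rewrite opprK [u + a]addrC /D0 scaleNr !edotNl !edotNr opprK edotZl edotZr.
set e := edot (a + u) (a + u); have e0 : 0 <= e by exact: edot_ge0.
rewrite lerD2l lerN2.
(* This is [thP] in terms of [k]: the gain gamma (1 - k) from strong convexity covers k v_i /
   (lambda n). *)
have kv : k * (v i / (lambda * n%:R) + gamma) <= gamma.
  rewrite (_ : k * _ = theta * (v i + lambda * gamma * n%:R) /
    (p i * lambda * n%:R)); last by rewrite /k; field; rewrite !gt_eqF.
  rewrite ler_pdivrMr ?mulr_gt0//; apply: le_trans (thP i) _.
  by rewrite le_eqVlt; apply/orP; left; apply/eqP; ring.
have ke : 0 <= k * e / 2 by rewrite divr_ge0// mulr_ge0//; case/andP: k01.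
have := ler_wpM2l ke kv.
rewrite (_ : k * e / 2 * (k * _) = v i * (k * (k * e)) / (2 * lambda * n%:R)
  + k * e / 2 * (k * gamma)). by lra.
by field; rewrite !gt_eqF.
Qed.

(** For Option II the two inner products with the gradient of g^* cancel. For Option I this is the
    optimality of [D] against [D0], combined with [increment0_bound]. *)
Lemma increment_bound D :
  quartz_increment opt A phi g lambda theta p v i a ab w D ->
  (fconj (phi i) (- (a + D)) <=
    (k * (edot x u - phi i x) + (1 - k) * c
     - k * edot (grad_fconj g ab) (A i *m (a + u))
     - edot (grad_fconj g ab) (A i *m D)
     - v i * edot D D / (2 * lambda * n%:R))%:E)%E.
Proof.
have DA : edot (grad_fconj g ab) (A i *m D0) =
    - k * edot (grad_fconj g ab) (A i *m (a + u)).
  by rewrite -scalemxAr edotZr.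
rewrite /quartz_increment; case: opt => [/=/(_ D0)|]; last first.
  have DE : - k *: a - k *: u = D0 by rewrite -[X in _ + X]scaleNr -scalerDr.
  rewrite -/x -/u -/k DE => ->; apply: le_trans increment0_bound _.
  by rewrite lee_fin DA; lra.
(* The conjugate is finite at [D0], so optimality makes it finite at [D] and the comparison is one
   of real numbers. *)
have := fconj_fin increment0_bound.
move: increment0_bound; move: (fconj _ (- (a + D0))) => [z| |]//=.
rewrite lee_fin => hz _; rewrite !enorm_sqr -!EFinD.
move: (fconj_ltNy (phi i) (- (a + D))).
case: (fconj _ _) => [y| |]//= _.
rewrite -!EFinD !lee_fin DA; lra.
Qed.

End Bound.

(** Two maximizers for Option I are compared with their midpoint; strong convexity of the conjugate
    then leaves gamma |D1 - D2|^2 <= 0. *)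
Lemma increment_unique i a ab w D1 D2 : fconj (phi i) (- a) \is a fin_num ->
  quartz_increment opt A phi g lambda theta p v i a ab w D1 ->
  quartz_increment opt A phi g lambda theta p v i a ab w D2 -> D1 = D2.
Proof.
move=> ac; have {}ac : (fconj (phi i) (- a) <= (fine (fconj (phi i) (- a)))%:E)%E.
  by rewrite fineK.
move=> h1 h2; have f1 := fconj_fin (increment_bound ac h1).
have f2 := fconj_fin (increment_bound ac h2).
move: h1 h2; rewrite /quartz_increment; case: opt => [|-> ->//].
set y1 := fine (fconj (phi i) (- (a + D1))).
set y2 := fine (fconj (phi i) (- (a + D2))).
have t01 : 0 <= (2^-1 : R) <= 1 by lra.
have := @sconj i 2^-1 (- (a + D1)) (- (a + D2)) y1 y2 t01.
rewrite !fineK// !lexx => /(_ isT isT).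
have -> : 2^-1 *: - (a + D1) + (1 - 2^-1) *: - (a + D2) =
    - (a + 2^-1 *: (D1 + D2)).
  by apply/colP => j; rewrite !mxE; field.
move=> hm; have fm := fconj_fin hm.
move=> /(_ (2^-1 *: (D1 + D2))) h1 /(_ (2^-1 *: (D1 + D2))) h2.
move: hm h1 h2; rewrite -(fineK fm) -(fineK f1) -(fineK f2) -/y1 -/y2.
rewrite (_ : - (a + D1) - - (a + D2) = - (D1 - D2)); last first.
  by apply/colP => j; rewrite !mxE; ring.
rewrite -!EFinN -!EFinD !lee_fin !enorm_sqr edotNl edotNr opprK.
have q0 := edot_ge0 (D1 - D2).
have vq : 0 <= v i * edot (D1 - D2) (D1 - D2) / (2 * lambda * n%:R).
  by rewrite divr_ge0 ?mulr_ge0// ltW.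
rewrite -scalemxAr mulmxDr => hm h1 h2.
apply/eqP; rewrite -subr_eq0 -edot_eq0 eq_le q0 andbT -(pmulr_rle0 _ gam0).
by move: vq hm h1 h2; rewrite !edotE (edotC D2 D1); lra.
Qed.

End Increment.

(** * One iteration in expectation *)

Section Step.
Context {R : realType} {n d m : nat}.
Variables (phi : 'I_n -> 'cV[R]_m -> R) (g : 'cV[R]_d -> R).
Variables (A : 'I_n -> 'M[R]_(d, m)) (gamma lambda theta : R).
Variables (q : {set 'I_n} -> R) (v : 'I_n -> R) (opt : quartz_option).
Hypotheses (n0 : (0 < n)%N) (gam0 : 0 < gamma) (l0 : 0 < lambda).
Hypotheses (cphi : forall i, convex_function setT (phi i))
  (dphi : forall i x, differentiable (phi i) x)
  (lphi : forall i x y,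
     enorm (grad (phi i) x - grad (phi i) y) <= gamma^-1 * enorm (x - y)).
Hypothesis sg : strongly_convex1 g.
Hypotheses (q0 : forall B, 0 <= q B) (q1 : \sum_B q B = 1).
Hypotheses (p0 : forall i, 0 < marginal q i) (v0 : forall i, 0 <= v i).
Hypothesis eso : forall h : 'I_n -> 'cV[R]_m,
  \sum_B q B * edot (\sum_(i in B) A i *m h i) (\sum_(i in B) A i *m h i) <=
  \sum_i marginal q i * v i * edot (h i) (h i).
Hypotheses (th0 : 0 <= theta) (th1 : theta <= 1)
  (thP : forall i, theta * (v i + lambda * gamma * n%:R) <=
                   marginal q i * (lambda * gamma * n%:R)).

Definition block_update (alpha Delta : 'I_n -> 'cV[R]_m) (B : {set 'I_n}) i :=
  if i \in B then alpha i + Delta i else alpha i.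

Lemma alpha_bar_update alpha Delta B :
  alpha_bar A lambda (block_update alpha Delta B) = alpha_bar A lambda alpha +
    (lambda * n%:R)^-1 *: \sum_(i in B) A i *m Delta i.
Proof.
rewrite /alpha_bar -scalerDr; congr (_ *: _).
rewrite [X in _ + X]big_mkcond -big_split/=; apply: eq_bigr => i _.
by rewrite /block_update; case: ifP => _; rewrite ?mulmxDr ?addr0.
Qed.

Lemma sum_marginal (F : 'I_n -> R) :
  \sum_B q B * (\sum_(i in B) F i) = \sum_i marginal q i * F i.
Proof.
under eq_bigr do rewrite mulr_sumr big_mkcond/=.
rewrite exchange_big; apply: eq_bigr => i _.
by rewrite -big_mkcond/= mulr_suml.
Qed.

Variables (w : 'cV[R]_d) (alpha Delta : 'I_n -> 'cV[R]_m).
Hypothesis da : dual_dom phi alpha.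
Let ab := alpha_bar A lambda alpha.
Let z := grad_fconj g ab.
Let w' := (1 - theta) *: w + theta *: z.
Hypothesis DeltaP : forall i, quartz_increment opt A phi g lambda theta
  (marginal q) v i (alpha i) ab w' (Delta i).

Let x i := (A i)^T *m w'.
Let u i := grad (phi i) (x i).
Let c i := fine (fconj (phi i) (- alpha i)).
Let K i := theta / marginal q i * (edot (x i) (u i) - phi i (x i))
  + (1 - theta / marginal q i) * c i
  - theta / marginal q i * edot z (A i *m (alpha i + u i))
  - edot z (A i *m Delta i) - v i * edot (Delta i) (Delta i) / (2 * lambda * n%:R).

Let KP i : (fconj (phi i) (- (alpha i + Delta i)) <= (K i)%:E)%E.
Proof.
apply: (increment_bound n0 gam0 l0 cphi dphi lphi p0 v0 th0 thP _ (DeltaP i)).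
by rewrite fineK.
Qed.

(** The gradient inequality at [x i], tested at A_i^T w and scaled by 1 - theta; expanding [w'] in
    <u_i,x_i> produces the term in [z]. *)
Let primal_step i : phi i (x i)
    + theta * (edot (x i) (u i) - phi i (x i)) - theta * edot z (A i *m u i) <=
  (1 - theta) * phi i ((A i)^T *m w).
Proof.
have th1' : 0 <= 1 - theta by rewrite subr_ge0.
have := ler_wpM2l th1' (convex_grad (dphi i) (x i) (cphi i) ((A i)^T *m w)).
have : edot (u i) (x i) = (1 - theta) * edot (u i) ((A i)^T *m w)
    + theta * edot z (A i *m u i).
  have xE : x i = (1 - theta) *: ((A i)^T *m w) + theta *: ((A i)^T *m z).
    by rewrite /x mulmxDr !scalemxAr.
  by rewrite (edot_mulmx (A i) (u i) z) (edotC _ (u i)) [X in edot _ X]xE !edotE.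
rewrite -/(u i) edotDr edotNr (edotC (x i)); lra.
Qed.

(** Convexity of g along [w'], where g z = <z,ab> - g^* ab because [ab] is a subgradient at [z]. *)
Let g_step : g w' <= (1 - theta) * g w + theta * (edot z ab - fine (fconj g ab)).
Proof.
have gz := fconj_subgradient (subgradient_grad_fconj sg ab).
rewrite gz /= -/z [edot z ab - (_ - _)]subKr.
have := (convex_functionTP g).2 sg.1 (1 - theta) w z.
by rewrite subKr subr_ge0 th1 gerBl th0; exact.
Qed.

Lemma gap_contraction :
  \sum_B q B * gap phi g A lambda w' (block_update alpha Delta B) <=
  (1 - theta) * gap phi g A lambda w alpha.
Proof.
have N0 : 0 < n%:R :> R by rewrite ltr0n.
pose h (B : {set 'I_n}) := \sum_(i in B) A i *m Delta i.
pose s i := edot z (A i *m Delta i).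
(* [U B] bounds the gap after drawing [B], by smoothness of g^* and by [KP] on the updated
   blocks. *)
pose U (B : {set 'I_n}) := primal A phi g lambda w' + lambda * fine (fconj g ab)
  + n%:R^-1 * \sum_i c i
  + n%:R^-1 * \sum_(i in B) (s i + (K i - c i))
  + (2 * lambda * n%:R ^+ 2)^-1 * edot (h B) (h B).
apply: (@le_trans _ _ (\sum_B q B * U B)).
  apply: ler_sum => B _; rewrite ler_wpM2l//.
  rewrite /gap alpha_bar_update -/ab -/(h B).
  have := fconj_smooth sg ab ((lambda * n%:R)^-1 *: h B).
  move/(ler_wpM2l (ltW l0)); rewrite -/z !edotE edot_sumr -/s.
  have : n%:R^-1 * \sum_i fine (fconj (phi i) (- block_update alpha Delta B i))
      <= n%:R^-1 * \sum_i c i + n%:R^-1 * \sum_(i in B) (K i - c i).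
    rewrite -mulrDr ler_wpM2l ?invr_ge0// [X in _ + X]big_mkcond -big_split/=.
    apply: ler_sum => i _; rewrite /block_update; case: ifP => _.
      by rewrite subrKC -lee_fin fineK// (fconj_fin (KP i)).
    by rewrite addr0.
  rewrite (_ : lambda * (_ + _ + _) = lambda * fine (fconj g ab)
    + n%:R^-1 * (\sum_(i in B) s i)
    + (2 * lambda * n%:R ^+ 2)^-1 * edot (h B) (h B)); last first.
    by field; rewrite !gt_eqF.
  rewrite /U [\sum_(i in B) (s i + _)]big_split/= [n%:R^-1 * (_ + _)]mulrDr.
  lra.
(* [W i] is what the expectation leaves for block [i]: the marginals cancel the divisions in [K],
   and its v_i term absorbs the quadratic term through [eso]. *)
pose W i := theta * (edot (x i) (u i) - phi i (x i)) - theta * c i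
  - theta * edot z (A i *m (alpha i + u i)).
apply: (@le_trans _ _ (primal A phi g lambda w' + lambda * fine (fconj g ab)
    + n%:R^-1 * \sum_i (c i + W i))).
  have lin (a b : R) (F1 F2 : {set 'I_n} -> R) :
      \sum_B q B * (a + n%:R^-1 * F1 B + b * F2 B) =
      a + n%:R^-1 * (\sum_B q B * F1 B) + b * \sum_B q B * F2 B.
    rewrite !mulr_sumr -[a in RHS]mulr1 -q1 mulr_sumr -!big_split/=.
    by apply: eq_bigr => B _; ring.
  rewrite /U lin sum_marginal [\sum_(i < n) (c i + W i)]big_split/=.
  rewrite [n%:R^-1 * (_ + _)]mulrDr [X in _ <= X]addrA -[X in X <= _]addrA lerD2l.
  have b0 : 0 <= (2 * lambda * n%:R ^+ 2)^-1.
    by rewrite invr_ge0 !mulr_ge0 ?exprn_ge0// ltW.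
  have := ler_wpM2l b0 (eso Delta); rewrite -/h => /(lerD (lexx _)) /le_trans.
  apply; rewrite !mulr_sumr -big_split/=; apply: ler_sum => i _.
  rewrite le_eqVlt; apply/orP; left; apply/eqP.
  by rewrite /K /W /s; field; rewrite !gt_eqF.
(* This cancels the inner product <z,ab> left over by [g_step]. *)
have zab : n%:R^-1 * (\sum_i edot z (A i *m alpha i)) = lambda * edot z ab.
  by rewrite /ab /alpha_bar edotZr edot_sumr; field; rewrite !gt_eqF.
have : n%:R^-1 * \sum_i (phi i (x i) + (c i + W i)) <=
    n%:R^-1 * \sum_i ((1 - theta) * phi i ((A i)^T *m w) + (1 - theta) * c i
      - theta * edot z (A i *m alpha i)).
  rewrite ler_wpM2l ?invr_ge0 ?(ltW N0)//; apply: ler_sum => i _.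
  by have := primal_step i; rewrite /W mulmxDr edotDr; lra.
rewrite [X in _ * X <= _]big_split/= sumrB [X in _ <= _ * (X - _)]big_split/=.
rewrite -!mulr_sumr [X in X <= _]mulrDr [X in _ <= X]mulrBr mulrCA zab.
have := ler_wpM2l (ltW l0) g_step; rewrite /gap /primal -/ab -/c.
move: (n%:R^-1 * \sum_i (c i + W i)) (\sum_i phi i (x i)) => y1 y2.
lra.
Qed.

End Step.

(** * Trajectories along independent draws *)

Section Histories.
Context {R : realType} {X : finType} (q : X -> R).
Hypothesis q0 : forall x, 0 <= q x.

Lemma big_tupleS T (G : seq X -> R) :
  \sum_(h : T.+1.-tuple X) G h = \sum_x \sum_(h : T.-tuple X) G (x :: h).
Proof.
rewrite pair_bigA/= (reindex (fun z : X * T.-tuple X => cons_tuple z.1 z.2))//=.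
exists (fun h : T.+1.-tuple X => (thead h, behead_tuple h)) => [[x h] _|h _]/=.
  by rewrite theadE; congr (_, _); exact/val_inj.
by rewrite [RHS]tuple_eta; exact/val_inj.
Qed.

Definition hist_mass (h : seq X) : R := \prod_(x <- h) q x.

(** Induction on the length, splitting off the first draw. [ok] is asked only along histories of
    positive mass, since only there is the contraction available. *)
Lemma hist_contraction (St : Type) (step : St -> X -> St) (V : St -> R)
    (ok : St -> Prop) (r : R) : 0 <= r ->
  (forall s, ok s -> \sum_x q x * V (step s x) <= r * V s) ->
  forall T s,
  (forall h, (size h < T)%N -> 0 < hist_mass h -> ok (foldl step s h)) ->
  \sum_(h : T.-tuple X) hist_mass h * V (foldl step s h) <= r ^+ T * V s.
Proof.
move=> r0 Vstep; elim=> [|T IH] s oks.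
  rewrite (eq_bigr (fun=> V s)) => [|h _]; last first.
    by rewrite tuple0/= /hist_mass big_nil mul1r.
  by rewrite sumr_const card_tuple expn0 expr0 mul1r.
rewrite (big_tupleS T (fun h => hist_mass h * V (foldl step s h))).
apply: (@le_trans _ _ (\sum_x q x * (r ^+ T * V (step s x)))); last first.
  rewrite exprS -mulrA mulrCA.
  under eq_bigr do rewrite mulrCA.
  rewrite -mulr_sumr ler_wpM2l ?exprn_ge0//; apply/Vstep/(oks [::]) => //.
  by rewrite /hist_mass big_nil.
apply: ler_sum => x _; under eq_bigr do rewrite /hist_mass big_cons -mulrA.
rewrite -mulr_sumr; have [->|qx] := eqVneq (q x) 0; first by rewrite !mul0r.
have {}qx : 0 < q x by rewrite lt_neqAle eq_sym qx q0.
rewrite ler_wpM2l//; apply: IH => h hT hm; apply: (oks (x :: h)) => //.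
by rewrite /hist_mass big_cons mulr_gt0.
Qed.

End Histories.

(** * The joint law of the first draws *)

Section Draws.
Context {R : realType} {disp : measure_display} {Omega : measurableType disp}.
Context {Pr : probability Omega R} {n : nat} {q : {set 'I_n} -> R}.
Variable S : nat -> Omega -> {set 'I_n}.
Hypothesis iidS : iid_draws Pr q S.

Definition draws (T : nat) (om : Omega) : T.-tuple {set 'I_n} :=
  [tuple of [seq S t om | t <- iota 0 T]].

Lemma nth_draws T om t : (t < T)%N -> nth finset.set0 (draws T om) t = S t om.
Proof. by move=> tT; rewrite (nth_map 0%N) ?size_iota// nth_iota. Qed.

Lemma draws_eqP T (h : T.-tuple {set 'I_n}) om :
  draws T om = h <-> forall t, (t < T)%N -> S t om = nth finset.set0 h t.
Proof.
split=> [<- t tT|Sh]; first by rewrite nth_draws.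
apply/val_inj/(@eq_from_nth _ finset.set0); first by rewrite !size_tuple.
by move=> t; rewrite size_tuple => tT; rewrite nth_draws// Sh.
Qed.

Lemma measurable_draws T (h : T.-tuple {set 'I_n}) :
  measurable [set om | draws T om = h].
Proof.
have [mS _ _] := iidS.
rewrite (_ : mkset _ =
    \bigcap_(t in [set t | (t < T)%N]) [set om | S t om = nth finset.set0 h t]).
  by apply: bigcap_measurableType => t _; exact: mS.
by apply/seteqP; split=> om /= => [/draws_eqP//|Sh]; apply/draws_eqP.
Qed.

Lemma prob_draws T (h : T.-tuple {set 'I_n}) :
  Pr [set om | draws T om = h] = (hist_mass q h)%:E.
Proof.
have [_ PS iS] := iidS.
have := iS (iota 0 T) (fun t => [set nth finset.set0 h t]%SET) (iota_uniq 0 T).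
rewrite (_ : mkset _ = [set om | draws T om = h]) => [->|]; last first.
  apply/seteqP; split=> om /= Sh.
    by apply/draws_eqP => t tT; apply/set1P/Sh; rewrite mem_iota.
  by move=> t; rewrite mem_iota => tT; apply/set1P; move/draws_eqP: Sh; exact.
rewrite /hist_mass (big_nth finset.set0) size_tuple /index_iota subn0 -prodEFin.
apply: eq_bigr => t _; rewrite -(PS t); congr (Pr _).
by apply/seteqP; split=> om /= /set1P.
Qed.

(** An event of nonzero probability is not empty. *)
Lemma draws_exists (h : seq {set 'I_n}) : hist_mass q h != 0 ->
  exists om, val (draws (size h) om) = h.
Proof.
move=> h0; have := prob_draws (in_tuple h).
apply: contraPP => /forallNP hN.
rewrite (_ : mkset _ = set0); last first.
  by rewrite -subset0 => om /= /(congr1 val)/= /hN.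
by rewrite measure0 => -[h0']; move/eqP: h0; rewrite -h0'.
Qed.

Lemma integral_draws T (F : T.-tuple {set 'I_n} -> R) :
  (forall om, 0 <= F (draws T om)) ->
  (\int[Pr]_om (F (draws T om))%:E)%E = 
    (\sum_(h : T.-tuple {set 'I_n}) hist_mass q h * F h)%:E.
Proof.
(* [F] may be negative at unattained histories, whose mass is 0: hence the
   absolute values below. *)
move=> F0; pose E (h : T.-tuple {set 'I_n}) := [set om | draws T om = h].
(* The integrand is a finite combination of indicators of histories, each measurable because the
   draws are. *)
have -> : (fun om => (F (draws T om))%:E) =
    (fun om => (\sum_h (`|F h|)%:E * (\1_(E h) om)%:E)%E).
  apply/funext => om; rewrite (bigD1 (draws T om))//= big1 => [|h hd].
    by rewrite adde0 indicE mem_set// mule1 ger0_norm.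
  by rewrite indicE memNset ?mule0// => dh; move/eqP: hd; rewrite -dh.
rewrite ge0_integral_sum//=; last first.
  move=> h; apply: emeasurable_funM => //.
  by apply/measurable_EFinP/measurable_indic; exact: measurable_draws.
rewrite -sumEFin; apply: eq_bigr => h _.
rewrite ge0_integralZl_EFin//=; last first.
  by apply/measurable_EFinP/measurable_indic; exact: measurable_draws.
rewrite integral_indic//; last exact: measurable_draws.
rewrite setIT (_ : (_ * _)%E = (hist_mass q h * `|F h|)%:E).
  have [->|h0] := eqVneq (hist_mass q h) 0; first by rewrite !mul0r.
  have [om] := draws_exists h0; rewrite size_tuple => /val_inj <-.
  by rewrite ger0_norm.
by rewrite mulrC EFinM; congr (_ * _)%E; exact: prob_draws.
Qed.

End Draws.

(** * The expected gap along a run *)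

Section Run.
Context {R : realType} {n d m : nat}.
Variables (phi : 'I_n -> 'cV[R]_m -> R) (g : 'cV[R]_d -> R).
Variables (A : 'I_n -> 'M[R]_(d, m)) (gamma lambda : R).
Variables (q : {set 'I_n} -> R) (v : 'I_n -> R) (opt : quartz_option).
Hypotheses (n0 : (0 < n)%N) (gam0 : 0 < gamma) (l0 : 0 < lambda).
Hypotheses (cphi : forall i, convex_function setT (phi i))
  (dphi : forall i x, differentiable (phi i) x)
  (lphi : forall i x y,
     enorm (grad (phi i) x - grad (phi i) y) <= gamma^-1 * enorm (x - y)).
Hypothesis sg : strongly_convex1 g.
Hypotheses (q0 : forall B, 0 <= q B) (q1 : \sum_B q B = 1).
Hypotheses (p0 : forall i, 0 < marginal q i) (v0 : forall i, 0 <= v i).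
Hypothesis eso : forall h : 'I_n -> 'cV[R]_m,
  \sum_B q B * edot (\sum_(i in B) A i *m h i) (\sum_(i in B) A i *m h i) <=
  \sum_i marginal q i * v i * edot (h i) (h i).
Local Notation theta := (quartz_theta lambda gamma (marginal q) v).
Hypotheses (th0 : 0 <= theta) (th1 : theta <= 1)
  (thP : forall i, theta * (v i + lambda * gamma * n%:R) <=
                   marginal q i * (lambda * gamma * n%:R)).

Definition next_primal (s : 'cV[R]_d * ('I_n -> 'cV[R]_m)) : 'cV[R]_d :=
  (1 - theta) *: s.1 + theta *: grad_fconj g (alpha_bar A lambda s.2).

Definition admissible (s : 'cV[R]_d * ('I_n -> 'cV[R]_m)) (i : 'I_n) :
    set 'cV[R]_m :=
  quartz_increment opt A phi g lambda theta (marginal q) v i (s.2 i)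
    (alpha_bar A lambda s.2) (next_primal s).

(* [xget] yields the junk value 0 for a coordinate without admissible
   increment; this can only occur after histories of mass 0. *)
Definition quartz_step s (B : {set 'I_n}) :=
  (next_primal s, block_update s.2 (fun i => xget 0 (admissible s i)) B).

(* The increment is unique, for Option I by strong concavity, so the state is a
   function of the past draws. *)
Lemma quartz_run_foldl alpha0 w0 S w ab alpha :
  dual_dom phi alpha0 ->
  quartz_run opt A phi g lambda gamma (marginal q) v alpha0 w0 S w ab alpha ->
  forall t, [/\ (w t, alpha t) =
      foldl quartz_step (w0, alpha0) [seq S k | k <- iota 0 t],
    ab t = alpha_bar A lambda (alpha t) & dual_dom phi (alpha t)].
Proof.
move=> da0 [w0E a0E ab0E run]; elim=> [|t [sE abE da]].
  by rewrite w0E a0E ab0E.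
have [wE [Delta [aN aS incr abS]]] := run t.
have w'E : w t.+1 = next_primal (w t, alpha t) by rewrite wE abE.
have aE : alpha t.+1 = block_update (alpha t) Delta (S t).
  apply/funext => i; rewrite /block_update; case: ifP => [/aS//|/negbT/aN//].
have adm i : i \in S t -> admissible (w t, alpha t) i (Delta i).
  by move=> iS; have := incr i iS; rewrite abE w'E.
split.
- have -> : iota 0 t.+1 = rcons (iota 0 t) t by rewrite -addn1 iotaD cats1.
  rewrite map_rcons foldl_rcons -sE /quartz_step w'E; congr (_, _).
  rewrite aE; apply/funext => i; rewrite /block_update; case: ifP => // iS.
  congr (_ + _); have Ai := adm i iS.
  apply: (increment_unique n0 gam0 l0 cphi dphi lphi p0 v0 th0 thP (da i) Ai).
  by apply: xgetPex; exists (Delta i).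
- by rewrite abS aE alpha_bar_update abE.
- move=> i; rewrite aE /block_update; case: ifP => [iS|_]; last exact: da.
  have ac : (fconj (phi i) (- alpha t i) <=
      (fine (fconj (phi i) (- alpha t i)))%:E)%E by rewrite fineK.
  apply: fconj_fin.
  exact: (increment_bound n0 gam0 l0 cphi dphi lphi p0 v0 th0 thP ac (adm i iS)).
Qed.

Variables (disp : measure_display) (Omega : measurableType disp).
Variables (Pr : probability Omega R) (alpha0 : 'I_n -> 'cV[R]_m).
Variables (w0 : 'cV[R]_d) (S : nat -> Omega -> {set 'I_n}).
Variables (w ab : nat -> Omega -> 'cV[R]_d).
Variable alpha : nat -> Omega -> 'I_n -> 'cV[R]_m.
Hypotheses (iidS : iid_draws Pr q S) (da0 : dual_dom phi alpha0).
Hypothesis run : forall om, quartz_run opt A phi g lambda gamma (marginal q) v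
  alpha0 w0 (S ^~ om) (w ^~ om) (ab ^~ om) (alpha ^~ om).

Let runE t om : [/\ (w t om, alpha t om) =
    foldl quartz_step (w0, alpha0) (draws S t om),
  ab t om = alpha_bar A lambda (alpha t om) & dual_dom phi (alpha t om)].
Proof. exact: (quartz_run_foldl da0 (run om)). Qed.

(* A history of positive mass is realised by some outcome, and so is its
   extension by a set containing [i]; the run at that outcome provides an
   increment of coordinate [i]. *)
Let admissible_exists h : 0 < hist_mass q h ->
  let s := foldl quartz_step (w0, alpha0) h in
  dual_dom phi s.2 /\ forall i, admissible s i !=set0.
Proof.
move=> h0 s; split.
  have [om omh] := draws_exists iidS (lt0r_neq0 h0).
  by have [sE _ da] := runE (size h) om; rewrite /s -omh -sE.
move=> i; have [B iB qB] : exists2 B : {set 'I_n}, i \in B & q B != 0.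
  apply: contrapT => nB; have := p0 i; rewrite /marginal big1 ?ltxx// => B iB.
  by apply: contrapT => /eqP qB; apply: nB; exists B.
have [|om] := @draws_exists _ _ _ _ _ _ _ iidS (rcons h B).
  by rewrite /hist_mass -cats1 big_cat big_seq1 mulf_neq0// lt0r_neq0.
rewrite size_rcons => omh.
have SB : S (size h) om = B.
  by rewrite -(nth_draws S om (ltnSn _)) omh nth_rcons ltnn eqxx.
have hE : val (draws S (size h) om) = h.
  apply: (@eq_from_nth _ finset.set0) => [|t]; rewrite size_tuple// => th.
  by rewrite nth_draws// -(nth_draws S om (leqW th)) omh nth_rcons th.
have [sE abE _] := runE (size h) om.
have [_ _ _ /(_ (size h))[wE [Delta [_ _ incr _]]]] := run om.
have -> : s = (w (size h) om, alpha (size h) om) by rewrite sE hE.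
by exists (Delta i); have := incr i; rewrite SB iB wE abE => /(_ isT).
Qed.

(** The state depends on finitely many draws only, so the integral is a finite sum over histories,
    to which the one-step contraction applies. *)
Lemma quartz_expected_gap T :
  (\int[Pr]_om ((primal A phi g lambda (w T om))%:E
                - dual A phi g lambda (alpha T om)) <=
   ((1 - theta) ^+ T * gap phi g A lambda w0 alpha0)%:E)%E.
Proof.
pose V (s : 'cV[R]_d * ('I_n -> 'cV[R]_m)) := gap phi g A lambda s.1 s.2.
pose F (h : T.-tuple {set 'I_n}) := V (foldl quartz_step (w0, alpha0) h).
have gapF om : gap phi g A lambda (w T om) (alpha T om) = F (draws S T om).
  by have [sE _ _] := runE T om; rewrite /F -sE.
under eq_integral => om _.
  rewrite gapE//; last by have [_ _] := runE T om.
  rewrite gapF; over.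
rewrite (integral_draws iidS) => [|om]; last first.
  by rewrite -gapF gap_ge0//; have [_ _] := runE T om.
rewrite lee_fin.
(* In such states [xget] returns a genuine increment for every coordinate, as [gap_contraction]
   requires. *)
pose ok (s : 'cV[R]_d * ('I_n -> 'cV[R]_m)) :=
  dual_dom phi s.2 /\ forall i, admissible s i !=set0.
apply: (@hist_contraction _ _ q q0 _ quartz_step V ok).
- by rewrite subr_ge0.
- move=> s [ds adm]; apply: (gap_contraction n0 gam0 l0 cphi dphi lphi sg q0 q1
    p0 v0 eso th0 th1 thP ds) => i.
  exact: (xgetPex 0 (adm i)).
- by move=> h _; exact: admissible_exists.
Qed.

End Run.

(** * Bounds on theta and the resulting iteration count *)

Section Rate.
Context {R : realType} {n : nat}.
Variables (gamma lambda tau : R) (p v : 'I_n -> R).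
Hypotheses (n0 : (0 < n)%N) (gam0 : 0 < gamma) (l0 : 0 < lambda).
Hypotheses (t0 : 0 < tau) (pE : forall i, p i = tau / n%:R).
Hypothesis v0 : forall i, 0 <= v i.

Lemma quartz_theta_le i :
  quartz_theta lambda gamma p v * (v i + lambda * gamma * n%:R) <=
  p i * (lambda * gamma * n%:R).
Proof.
have L0 : 0 < lambda * gamma * n%:R by rewrite !mulr_gt0// ltr0n.
rewrite -ler_pdivlMr ?ltr_wpDl// !mulrA; apply: ge_inf; last by exists i.
exists 0 => _ [j _ <-]; rewrite divr_ge0//; last by rewrite ltW// ltr_wpDl.
by rewrite -!mulrA mulr_ge0 ?pE ?divr_ge0 ?(ltW t0)// mulrA ltW.
Qed.

Let v_le_sup i : v i <= sup [set v i | i in [set: 'I_n]].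
Proof.
apply: ub_le_sup; last by exists i.
by exists (\sum_i v i) => _ [j _ <-]; rewrite (bigD1 j)//= lerDl sumr_ge0.
Qed.

Lemma quartz_rate_gt0 : 0 < n%:R / tau
    + sup [set v i | i in [set: 'I_n]] / (lambda * gamma * tau).
Proof.
rewrite ltr_pwDl ?divr_gt0 ?ltr0n// divr_ge0//; last by rewrite ltW// !mulr_gt0.
exact: le_trans (v0 (Ordinal n0)) (v_le_sup _).
Qed.

(** For p_i = tau / n each quotient in theta is the inverse of n / tau + v_i / (lambda gamma tau),
    and v_i is at most the supremum. *)
Lemma quartz_theta_ge : (n%:R / tau
    + sup [set v i | i in [set: 'I_n]] / (lambda * gamma * tau))^-1 <=
  quartz_theta lambda gamma p v.
Proof.
have L0 : 0 < lambda * gamma * n%:R by rewrite !mulr_gt0// ltr0n.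
have N0 : 0 < n%:R :> R by rewrite ltr0n.
apply: lb_le_inf; first by eexists; exists (Ordinal n0).
move=> _ [i _ <-]; have := v_le_sup i; set s := sup _ => vs.
have s0 : 0 <= s by exact: le_trans vs.
rewrite pE (_ : _ / _ * _ * _ * _ = lambda * gamma * tau); last first.
  by field; rewrite gt_eqF.
rewrite (_ : _ + _ = (s + lambda * gamma * n%:R) / (lambda * gamma * tau)).
  by rewrite invf_div ler_pM2l ?mulr_gt0// lef_pV2 ?posrE ?ltr_wpDl// lerD2r.
by field; rewrite !gt_eqF.
Qed.

End Rate.

(** From 1 - theta <= exp (- theta), the power is at most exp (- theta T), and theta T >= T / kappa
    >= ln (G / eps). *)
Lemma expr_one_minus_le (R : realType) (theta kappa G eps : R) (T : nat) :
  0 < eps -> eps <= G -> 0 < kappa -> kappa^-1 <= theta -> theta <= 1 ->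
  kappa * ln (G / eps) <= T%:R -> (1 - theta) ^+ T * G <= eps.
Proof.
move=> e0 eG k0 kt t1 kT; have G0 : 0 < G by exact: lt_le_trans eG.
rewrite -ler_pdivlMr// -[eps / G]invf_div -[G / eps]lnK ?posrE ?divr_gt0//.
rewrite -expRN; apply: (@le_trans _ _ (expR (- theta) ^+ T)).
  by rewrite lerXn2r ?nnegrE ?subr_ge0 ?expR_ge0// expR_ge1Dx.
rewrite -expRM_natl ler_expR mulrN lerN2.
apply: (@le_trans _ _ (T%:R * kappa^-1)); last by rewrite ler_wpM2l.
by rewrite ler_pdivlMr// mulrC.
Qed.

Theorem corollary13 (R : realType) (n d m : nat)
    (phi : 'I_n -> 'cV[R]_m -> R) (g : 'cV[R]_d -> R)
    (A : 'I_n -> 'M[R]_(d, m)) (gamma lambda : R) (tau : nat)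
    (opt : quartz_option)
    (disp : measure_display) (Omega : measurableType disp)
    (Pr : probability Omega R)
    (alpha0 : 'I_n -> 'cV[R]_m) (w0 : 'cV[R]_d)
    (S : nat -> Omega -> {set 'I_n})
    (w ab : nat -> Omega -> 'cV[R]_d)
    (alpha : nat -> Omega -> 'I_n -> 'cV[R]_m)
    (eps : R) (T : nat) :
  (2 <= n)%N ->
  0 < gamma ->
  0 < lambda ->
  (forall i, convex_function setT (phi i)) ->
  (forall i x, differentiable (phi i) x) ->
  (forall i x y,
     enorm (grad (phi i) x - grad (phi i) y) <= gamma^-1 * enorm (x - y)) ->
  strongly_convex1 g ->
  (forall i, A i != 0) ->
  (1 <= tau <= n)%N ->
  iid_draws Pr (nice_law R tau) S ->
  (forall om,
     quartz_run opt A phi g lambda gamma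
       (marginal (nice_law R tau)) (nice_stepsize A tau) alpha0 w0
       (fun t => S t om) (fun t => w t om) (fun t => ab t om)
       (fun t => alpha t om)) ->
  0 < eps ->
  (eps%:E <= (primal A phi g lambda w0)%:E - dual A phi g lambda alpha0)%E ->
  ((n%:R / tau%:R
    + sup [set nice_stepsize A tau i | i in [set: 'I_n]]
      / (lambda * gamma * tau%:R))%:E
   * lne (((primal A phi g lambda w0)%:E - dual A phi g lambda alpha0)
          / eps%:E)
   <= (T%:R : R)%:E)%E ->
  (\int[Pr]_om ((primal A phi g lambda (w T om))%:E
                - dual A phi g lambda (alpha T om)) <= eps%:E)%E.
Proof.
move=> n2 gam0 l0 cphi dphi lphi sg A0 taun iidS run e0.
have n0 : (0 < n)%N by exact: ltnW.
have t0 : 0 < tau%:R :> R by rewrite ltr0n; case/andP: taun.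
have N0 : 0 < n%:R :> R by rewrite ltr0n.
have v0 i : 0 <= nice_stepsize A tau i by exact: nice_stepsize_ge0.
have pE (i : 'I_n) : marginal (nice_law R tau) i = tau%:R / n%:R.
  exact: marginal_nice.
have p0 (i : 'I_n) : 0 < marginal (nice_law R tau) i by rewrite pE divr_gt0.
have eso := nice_eso taun n2 A.
have thP := quartz_theta_le n0 gam0 l0 t0 pE v0.
have kth := quartz_theta_ge n0 gam0 l0 t0 pE v0.
have k0 := quartz_rate_gt0 n0 gam0 l0 t0 v0.
set kappa := _ + _ / _ in kth k0 *; set G0 := (_ - dual _ _ _ _ _)%E.
have th0 : 0 <= quartz_theta lambda gamma (marginal (nice_law R tau))
    (nice_stepsize A tau) by apply: le_trans kth; rewrite invr_ge0 ltW.
have th1 : quartz_theta lambda gamma (marginal (nice_law R tau))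
    (nice_stepsize A tau) <= 1.
  apply: le_trans (theta_le_marginal n0 gam0 l0 v0 th0 thP (Ordinal n0)) _.
  by rewrite pE ler_pdivrMr// mul1r ler_nat; case/andP: taun.
move=> eG kT.
(* An infinite initial gap would make the required number of iterations infinite, against the bound
   by [T]; hence [alpha0] lies in [dual_dom]. *)
have G0y : (G0 < +oo)%E.
  rewrite ltey; apply/eqP => Gy; move: kT; rewrite Gy inver gt_eqF//.
  by rewrite gt0_mulye ?lte_fin ?invr_gt0// gt0_muley ?lte_fin.
have da0 := dual_domP n0 sg G0y.
have GE := gapE A lambda sg w0 da0.
move: eG kT; rewrite /G0 GE inver gt_eqF// -EFinM lee_fin => eG.
rewrite lne_EFin ?divr_gt0 ?(lt_le_trans e0)// -EFinM lee_fin => kT.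
apply: (le_trans (quartz_expected_gap n0 gam0 l0 cphi dphi lphi sg
  (@nice_law_ge0 R n tau) (nice_law_sum1 taun) p0 v0 eso th0 th1 thP iidS da0
  run T)).
rewrite lee_fin; exact: expr_one_minus_le kT.
Qed.
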